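(* Let $\mathcal{U}$ be a strategic $(p^+)$-filter on $E$. Then every Borel set $\mathbb{A}\subseteq 2^\omega\times E^{[\infty]}$ is perfectly $\mathcal{U}$-strategically Ramsey.
   Context: $F$ is a countable field and $E$ a countably infinite-dimensional $F$-vector space with fixed basis $(e_n)$; $\mathrm{supp}(v)$ is the set of indices of nonzero coefficients of $v\ne0$. Block sequences: sequences of nonzero vectors with $\max\mathrm{supp}(x_n)<\min\mathrm{supp}(x_{n+1})$; $E^{[\infty]}$ (Polish, subspace of $E^\omega$) and $E^{[<\infty]}$ are the infinite and finite ones. $Y\preceq X$ iff $\langle Y\rangle\subseteq\langle X\rangle$; $Y\preceq^*X$ iff some tail of $Y$ is $\preceq X$. Family: nonempty subset of $E^{[\infty]}$ upward closed under $\preceq^*$; filter: family whose any two members have a common $\preceq$-lower bound in it; $\mathcal{H}\restriction X=\{Y\in\mathcal{H}:Y\preceq X\}$. Full: whenever $D\subseteq E$ and $X\in\mathcal{H}$ are such that every $Y\in\mathcal{H}\restriction X$ has some $Z\preceq Y$ with $\langle Z\rangle\subseteq D$, there is $Z\in\mathcal{H}\restriction X$ with $\langle Z\rangle\subseteq D$. $(p)$: every $\preceq$-decreasing sequence in $\mathcal{H}$ has a member of $\mathcal{H}$ that is $\preceq^*$ each term; $(p^+)$-filter: full filter with $(p)$. Strategic: whenever $X\in\mathcal{H}$ and $\alpha$ is a strategy for II in $G[X]$, some outcome of $\alpha$ lies in $\mathcal{H}$. Games for $\vec x\in E^{[<\infty]}$, $X\in E^{[\infty]}$: in $F[\vec x,X]$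 I plays $n_k\in\omega$, II plays nonzero $y_k\in\langle X\rangle$ with $n_k<\min\mathrm{supp}(y_k)$; in $G[\vec x,X]$ I plays $Y_k\in E^{[\infty]}$, $Y_k\preceq X$, II plays nonzero $y_k\in\langle Y_k\rangle$; II's moves are supported above $\vec x$ and form a block sequence; outcome $\vec x^\frown(y_k)$; $G[X]=G[\emptyset,X]$. $[\sigma]$ is the set of outcomes of plays where I follows $\sigma$. $\mathbb{S}$: nonempty perfect subtrees of $2^{<\omega}$ ordered by inclusion; $[p]$ the branches of $p$. $\mathbb{A}$ is perfectly $\mathcal{U}$-strategically Ramsey if for every $\vec x\in E^{[<\infty]}$, $X\in\mathcal{U}$ and $p\in\mathbb{S}$ there are $Y\in\mathcal{U}\restriction X$ and $q\le p$ such that either (i) I has a strategy $\sigma$ in $F[\vec x,Y]$ with $([q]\times[\sigma])\cap\mathbb{A}=\emptyset$, or (ii) for every $f\in[q]$, II has a strategy in $G[\vec x,Y]$ all of whose outcomes lie in $\mathbb{A}_f=\{Z:(f,Z)\in\mathbb{A}\}$. *)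

(* Defs.v *)
(* E is modelled as {poly F}: finitely supported coefficient
   sequences, with fixed basis e_n = 'X^n (so v`_n is the n-th coordinate). *)
From HB Require Import structures.
From mathcomp Require Import all_boot all_order all_algebra.
Set Implicit Arguments. Unset Strict Implicit. Unset Printing Implicit Defensive.
Import GRing.Theory.
Local Open Scope ring_scope.

Section Defs.
Variable F : countFieldType.
Notation vec := {poly F}.

Definition supp_before (u v : vec) : Prop :=
  forall i j : nat, u`_i != 0 -> v`_j != 0 -> (i < j)%N.

Definition is_block (X : nat -> vec) : Prop :=
  (forall n, X n != 0) /\ (forall n, supp_before (X n) (X n.+1)).

Definition is_block_fin (s : seq vec) : Prop :=
  (forall i, (i < size s)%N -> nth 0 s i != 0) /\
  (forall i, (i.+1 < size s)%N -> supp_before (nth 0 s i) (nth 0 s i.+1)).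

Definition in_span (X : nat -> vec) (v : vec) : Prop :=
  exists (n : nat) (c : nat -> F), v = \sum_(i < n) c i *: X i.

Definition bleq (Y X : nat -> vec) : Prop := forall v, in_span Y v -> in_span X v.

Definition bleq_star (Y X : nat -> vec) : Prop :=
  exists k, bleq (fun n => Y (n + k)%N) X.

Definition is_family (H : (nat -> vec) -> Prop) : Prop :=
  (forall X, H X -> is_block X) /\ (exists X, H X) /\
  (forall X Y, H X -> is_block Y -> bleq_star X Y -> H Y).

Definition is_filter (H : (nat -> vec) -> Prop) : Prop :=
  is_family H /\
  (forall X Y, H X -> H Y -> exists Z, H Z /\ bleq Z X /\ bleq Z Y).

Definition is_full (H : (nat -> vec) -> Prop) : Prop :=
  forall (D : vec -> Prop) (X : nat -> vec), H X ->
    (forall Y, H Y -> bleq Y X ->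
       exists Z, is_block Z /\ bleq Z Y /\ (forall v, in_span Z v -> D v)) ->
    exists Z, H Z /\ bleq Z X /\ (forall v, in_span Z v -> D v).

Definition has_p (H : (nat -> vec) -> Prop) : Prop :=
  forall Xs : nat -> nat -> vec,
    (forall n, H (Xs n)) -> (forall n, bleq (Xs n.+1) (Xs n)) ->
    exists X, H X /\ forall n, bleq_star X (Xs n).

Definition is_pplus_filter (H : (nat -> vec) -> Prop) : Prop :=
  is_filter H /\ is_full H /\ has_p H.

Definition outcome (x : seq vec) (ys : nat -> vec) : nat -> vec :=
  fun n => if (n < size x)%N then nth 0 x n else ys (n - size x)%N.

Definition G_legal_I (X : nat -> vec) (Ys : nat -> nat -> vec) : Prop :=
  forall k, is_block (Ys k) /\ bleq (Ys k) X.

Definition G_legal_II (prev : seq vec) (Yk : nat -> vec) (y : vec) : Prop :=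
  y != 0 /\ in_span Yk y /\ (forall u, u \in prev -> supp_before u y).

Definition G_play_II (alpha : seq (nat -> vec) -> vec) (Ys : nat -> nat -> vec)
  : nat -> vec := fun k => alpha (mkseq Ys k.+1).

Definition is_strategy_II_G (x : seq vec) (X : nat -> vec)
  (alpha : seq (nat -> vec) -> vec) : Prop :=
  forall Ys, G_legal_I X Ys -> forall k,
    G_legal_II (x ++ mkseq (G_play_II alpha Ys) k) (Ys k) (G_play_II alpha Ys k).

(* a strategy for I maps II's previous moves y_0..y_{k-1} to n_k;
   ys is a play where I follows sigma *)
Definition F_follows (x : seq vec) (X : nat -> vec) (sigma : seq vec -> nat)
  (ys : nat -> vec) : Prop :=
  forall k, ys k != 0 /\ in_span X (ys k) /\
    (forall i, (ys k)`_i != 0 -> (sigma (mkseq ys k) < i)%N) /\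
    (forall u, u \in x ++ mkseq ys k -> supp_before u (ys k)).

Definition is_strategic (H : (nat -> vec) -> Prop) : Prop :=
  forall X (alpha : seq (nat -> vec) -> vec), H X -> is_strategy_II_G [::] X alpha ->
    exists Ys, G_legal_I X Ys /\ H (outcome [::] (G_play_II alpha Ys)).

Definition is_perfect_tree (p : seq bool -> Prop) : Prop :=
  (exists s, p s) /\ (forall s t, p (s ++ t) -> p s) /\
  (forall s, p s -> exists t, p (s ++ t ++ [:: false]) /\ p (s ++ t ++ [:: true])).

Definition branch (p : seq bool -> Prop) (f : nat -> bool) : Prop :=
  forall n, p (mkseq f n).

(* ----- Borel sets of 2^omega x E^omega (product of discrete spaces) ----- *)
Definition point := ((nat -> bool) * (nat -> vec))%type.

Definition cyl (n : nat) (z w : point) : Prop :=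
  forall i, (i < n)%N -> w.1 i = z.1 i /\ w.2 i = z.2 i.

Definition is_open (U : point -> Prop) : Prop :=
  forall z, U z -> exists n, forall w, cyl n z w -> U w.

Inductive Borel : (point -> Prop) -> Prop :=
| Borel_open U : is_open U -> Borel U
| Borel_compl A : Borel A -> Borel (fun z => ~ A z)
| Borel_union (A : nat -> point -> Prop) :
    (forall n, Borel (A n)) -> Borel (fun z => exists n, A n z)
| Borel_ext A B : Borel A -> (forall z, A z <-> B z) -> Borel B.

Definition perfectly_strategically_Ramsey (U : (nat -> vec) -> Prop)
  (A : point -> Prop) : Prop :=
  forall (x : seq vec) (X : nat -> vec) (p : seq bool -> Prop),
    is_block_fin x -> U X -> is_perfect_tree p ->
    exists (Y : nat -> vec) (q : seq bool -> Prop),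
      U Y /\ bleq Y X /\ is_perfect_tree q /\ (forall s, q s -> p s) /\
      ((exists sigma : seq vec -> nat,
          forall f ys, branch q f -> F_follows x Y sigma ys ->
            ~ A (f, outcome x ys))
       \/
       (forall f, branch q f ->
          exists alpha, is_strategy_II_G x Y alpha /\
            forall Ys, G_legal_I Y Ys -> A (f, outcome x (G_play_II alpha Ys)))).

End Defs.

(* Main.v *)
(** The argument is Rosendal's proof that analytic sets are strategically Ramsey,
   run simultaneously over all branches of a perfect tree.

   Write the Borel set as the projection of a closed set [C], so that it is
   [A_[::]] for the scheme [A_s = U_j A_(s^j)], where [A_s] consists of the points
   having a witness [g] that extends [s].  Call [(x, s)] good at a perfect tree
   [q] if, for some [Y] in the filter, I has one strategy in [F[x, Y]] avoiding
   [A_s] at every branch of [q].  A fusion yields a tree below which every such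
   property is decided at a finite level.  If [(x, s)] is bad along the branch
   [f], then II can reach in [G[x, Y]] a position [(x', s^j)] that is again bad
   along [f]; repeating this produces a witness, because [C] is closed.
   Otherwise I could keep away from all these positions while also following
   the strategies for the [A_(s^j)], and [(x, s)] would be good.

   The step that replaces "no move for II" by a single block sequence valid for
   all branches at once is a dichotomy for closed families [D_f] of sets of
   vectors: on some [q] and [Y] in the filter, either the span of [Y] lies in
   every [D_f], or no block sequence below [Y] has its span inside some [D_f].
   It is here that the filter has to be strategic: [Y] is the outcome of a play
   of [G] along which II also performs a fusion of perfect trees. *)
Require Import Defs.
From mathcomp Require Import all_boot all_order all_algebra.
From mathcomp Require Import boolp.
Set Implicit Arguments. Unset Strict Implicit. Unset Printing Implicit Defensive.
Import GRing.Theory.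
Local Open Scope ring_scope.

(** * Block sequences and spans *)

Section Spans.
Variable F : countFieldType.
Notation vec := {poly F}.
Implicit Types (X Y Z : nat -> vec) (u v y : vec) (h x : seq vec).

Definition beyond (N : nat) y := forall i, y`_i != 0 -> (N < i)%N.
Definition tail k X : nat -> vec := fun n => X (n + k)%N.
Definition fspan h v := in_span (nth 0 h) v.
Definition maxsize h := \max_(u <- h) size u.

Lemma span_ind X (P : vec -> Prop) :
  P 0 -> (forall u v, P u -> P v -> P (u + v)) -> (forall a n, P (a *: X n)) ->
  forall v, in_span X v -> P v.
Proof. by move=> P0 PD PX _ [n [c ->]]; elim/big_ind: _. Qed.

Lemma span_widen X n N (c : nat -> F) : (n <= N)%N ->
  \sum_(i < n) c i *: X i = \sum_(i < N) (if (i < n)%N then c i else 0) *: X i.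
Proof.
move=> nN; rewrite (big_ord_widen N (fun i => c i *: X i) nN) big_mkcond.
by apply: eq_bigr => i _; case: ifP; rewrite // scale0r.
Qed.

Lemma span0 X : in_span X 0.
Proof. by exists 0%N, (fun=> 0); rewrite big_ord0. Qed.

Lemma spanD X u v : in_span X u -> in_span X v -> in_span X (u + v).
Proof.
move=> [n [c ->]] [m [d ->]].
rewrite (@span_widen X n (maxn n m)) ?leq_maxl // (@span_widen X m (maxn n m)) ?leq_maxr //.
exists (maxn n m), (fun i => (if (i < n)%N then c i else 0) + (if (i < m)%N then d i else 0)).
by rewrite -big_split; apply: eq_bigr => i _; rewrite scalerDl.
Qed.

Lemma spanZ X a v : in_span X v -> in_span X (a *: v).
Proof.
move=> [n [c ->]]; exists n, (fun i => a * c i).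
by rewrite scaler_sumr; apply: eq_bigr => i _; rewrite scalerA.
Qed.

Lemma span_mem X n : in_span X (X n).
Proof.
exists n.+1, (fun i => if i == n then 1 else 0).
rewrite big_ord_recr /= eqxx scale1r big1 ?add0r // => i _.
by rewrite ltn_eqF ?scale0r.
Qed.

Lemma span_sub X Y : (forall n, in_span X (Y n)) -> bleq Y X.
Proof.
move=> H v; apply: (@span_ind Y); first exact: span0.
  by move=> *; apply: spanD.
by move=> *; apply: spanZ.
Qed.

Lemma bleq_trans X Y Z : bleq X Y -> bleq Y Z -> bleq X Z.
Proof. by move=> XY YZ v /XY/YZ. Qed.

Lemma bleq_tail k X : bleq (tail k X) X.
Proof. by apply: span_sub => n; apply: span_mem. Qed.

Lemma block_lt X m n : is_block X -> (m < n)%N -> supp_before (X m) (X n).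
Proof.
move=> [X0 XS]; elim: n => // n IH; rewrite ltnS leq_eqVlt => /orP[/eqP-> //|/IH mn] i j Xi Xj.
have [k Xk] : exists k, (X n)`_k != 0.
  by exists (size (X n)).-1; have := X0 n; rewrite -lead_coef_eq0 /lead_coef.
by apply: ltn_trans (mn _ _ Xi Xk) (XS _ _ _ Xk Xj).
Qed.

Lemma block_ge X n i : is_block X -> (X n)`_i != 0 -> (n <= i)%N.
Proof.
move=> bX; elim: n i => // n IH i Xi.
have [k Xk] : exists k, (X n)`_k != 0.
  by exists (size (X n)).-1; have := bX.1 n; rewrite -lead_coef_eq0 /lead_coef.
by apply: leq_ltn_trans (IH _ Xk) (bX.2 n _ _ Xk Xi).
Qed.

Lemma block_tail k X : is_block X -> is_block (tail k X).
Proof. by move=> [X0 XS]; split=> n; [apply: X0 | apply: XS]. Qed.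

Lemma tail_beyond N X v : is_block X -> in_span (tail N.+1 X) v -> beyond N v.
Proof.
move=> bX; apply: (@span_ind (tail N.+1 X)) => [i||a n i].
- by rewrite coef0 eqxx.
- move=> u w Hu Hw i; rewrite coefD.
  have [u0|/Hu //] := eqVneq u`_i 0; have [w0|/Hw //] := eqVneq w`_i 0.
  by rewrite u0 w0 addr0 eqxx.
- rewrite coefZ => nz; have /(block_ge bX) : (X (n + N.+1)%N)`_i != 0.
    by apply: contraNneq nz; rewrite /tail => ->; rewrite mulr0.
  by rewrite addnS; apply: leq_trans; rewrite ltnS leq_addl.
Qed.

(** Supports of distinct blocks are disjoint: if [c i] were nonzero for some [i < k], a nonzero
    coordinate of [v] below [N] would survive. *)
Lemma span_beyond_tail k N X v : is_block X ->
  (forall i, (i < k)%N -> (size (X i) <= N)%N) ->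
  in_span X v -> beyond N v -> in_span (tail k X) v.
Proof.
move=> bX sX [n [c ->]] bv.
have c0 i : (i < k)%N -> (i < n)%N -> c i = 0.
  elim/ltn_ind: i => i IH ik lin; apply/eqP/negPn/negP => ci.
  have [j Xj] : exists j, (X i)`_j != 0.
    by exists (size (X i)).-1; have := bX.1 i; rewrite -lead_coef_eq0 /lead_coef.
  have jN : (j < N)%N.
    apply: leq_trans (sX _ ik); rewrite ltnNge; apply/negP => /(nth_default 0) j0.
    by rewrite j0 eqxx in Xj.
  suff /bv : (\sum_(l < n) c l *: X l)`_j != 0 by rewrite ltnNge (ltnW jN).
  rewrite coef_sum (bigD1 (Ordinal lin)) //= big1 => [|l li].
    by rewrite addr0 coefZ mulf_neq0.
  rewrite coefZ; have [li'|il|E] := ltngtP l i.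
  - by rewrite IH ?mul0r // (ltn_trans li').
  - have [->|Xl] := eqVneq (X l)`_j 0; first by rewrite mulr0.
    by have := block_lt bX il Xj Xl; rewrite ltnn.
  - by case/eqP: li; apply: val_inj.
elim/big_ind: _ => [|*|i _]; [exact: span0|exact: spanD|].
have [ik|ki] := ltnP i k; first by rewrite c0 // scale0r; apply: span0.
by apply: spanZ; have := span_mem (tail k X) (i - k); rewrite /tail subnK.
Qed.

(** Measures $\preceq^*$ by supports instead of indices; in this form it passes to all block
    sequences below [Y]. *)
Lemma bleq_star_beyond Y W : is_block Y -> bleq_star Y W ->
  exists N, forall v, in_span Y v -> beyond N v -> in_span W v.
Proof.
move=> bY [k Hk]; exists (\max_(i < k) size (Y i)) => v Yv bv.
apply: Hk; apply: span_beyond_tail Yv bv => // i ik.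
exact: (leq_bigmax (Ordinal ik)).
Qed.

Lemma bleq_star_trans Z Y W : is_block Y -> is_block Z ->
  bleq Z Y -> bleq_star Y W -> bleq_star Z W.
Proof.
move=> bY bZ ZY /(bleq_star_beyond bY)[N HN]; exists N.+1 => v Zv.
by apply: HN; [apply/ZY/(bleq_tail Zv) | apply: tail_beyond Zv].
Qed.

Lemma maxsize_mem h u : u \in h -> (size u <= maxsize h)%N.
Proof. by move=> uh; apply: (leq_bigmax_seq (F := fun w : vec => size w)). Qed.

Lemma beyond_supp h y : beyond (maxsize h) y -> forall u, u \in h -> supp_before u y.
Proof.
move=> by_ u uh i j ui /by_; apply: leq_ltn_trans; apply: leq_trans (maxsize_mem uh).
by apply: ltnW; rewrite ltnNge; apply/negP => /(nth_default 0) u0; rewrite u0 eqxx in ui.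
Qed.

Lemma beyond_le M N y : (M <= N)%N -> beyond N y -> beyond M y.
Proof. by move=> MN H i /H; apply: leq_ltn_trans. Qed.

Lemma fspan_nil v : fspan [::] v -> v = 0.
Proof.
apply: (@span_ind _ (fun w => w = 0)) => // [u w -> ->|a n]; first by rewrite addr0.
by rewrite nth_nil scaler0.
Qed.

Lemma fspan_rcons h y v : fspan (rcons h y) v ->
  exists u a, fspan h u /\ v = u + a *: y.
Proof.
apply: (@span_ind _ (fun w => exists u a, fspan h u /\ w = u + a *: y)).
- by exists 0, 0; rewrite scale0r addr0; split => //; apply: span0.
- move=> _ _ [u [a [Hu ->]]] [w [b [Hw ->]]]; exists (u + w), (a + b).
  by rewrite scalerDl addrACA; split => //; apply: spanD.
- move=> a n; rewrite nth_rcons; case: ltngtP => [_|_|_].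
  + by exists (a *: nth 0 h n), 0; rewrite scale0r addr0; split => //; apply/spanZ/span_mem.
  + by exists 0, 0; rewrite scale0r addr0 scaler0; split => //; apply: span0.
  + by exists 0, a; rewrite add0r; split => //; apply: span0.
Qed.

Lemma span_fspan X v : in_span X v ->
  exists k, forall m, (k <= m)%N -> fspan (mkseq X m) v.
Proof.
move=> [n [c ->]]; exists n => m nm; exists n, c.
by apply: eq_bigr => i _; rewrite nth_mkseq // (leq_trans _ nm).
Qed.

End Spans.

(** * Diagonalisation in filters with $(p)$ *)

Section Filters.
Variable F : countFieldType.
Notation vec := {poly F}.
Implicit Types (X Y Z : nat -> vec).
Variable U : (nat -> vec) -> Prop.
Hypothesis famU : is_family U.
Hypothesis filU : forall X Y, U X -> U Y -> exists Z, U Z /\ bleq Z X /\ bleq Z Y.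

Lemma fam_block X : U X -> is_block X.
Proof. exact: famU.1. Qed.

Lemma finite_lower_bound (I : eqType) (r : seq I) (Zs : I -> nat -> vec) Y :
  U Y -> (forall i, i \in r -> U (Zs i)) ->
  exists Z, U Z /\ bleq Z Y /\ forall i, i \in r -> bleq Z (Zs i).
Proof.
move=> UY; elim: r => [|i r IH] Hr.
  by exists Y; split=> //; split.
have [|Z [UZ [ZY ZZ]]] := IH.
  by move=> j jr; apply: Hr; apply: mem_behead.
have [|W [UW [WZ Wi]]] := filU UZ (Hr i _); first by rewrite inE eqxx.
exists W; split=> //; split; first exact: bleq_trans WZ ZY.
move=> j; rewrite inE => /orP[/eqP-> //|/ZZ]; exact: bleq_trans.
Qed.

Hypothesis pU : has_p U.

(** One choice for each [i] is taken into account at a time, in the order of [unpickle]; $(p)$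
    applies to the resulting decreasing sequence. *)
Lemma countable_lower_bound (I : countType) (P : I -> (nat -> vec) -> Prop) X :
  U X -> (forall i, exists Y, U Y /\ P i Y) ->
  exists Y, U Y /\ bleq Y X /\ forall i, exists W, P i W /\ bleq_star Y W.
Proof.
move=> UX /choice[W HW].
(* The premise sits under the existential so that [choice] gives a total function; the same device
   recurs below. *)
have next (n : nat) (Z : nat -> vec) : exists Z', U Z -> U Z' /\ bleq Z' Z /\
    forall i, unpickle n = Some i -> bleq Z' (W i).
  case: (pselect (U Z)) => [UZ|nUZ]; last by exists Z => /nUZ.
  case En: (unpickle n) => [i|]; last by exists Z; split=> //; split.
  have [Z' [UZ' [Z'Z Z'W]]] := filU UZ (HW i).1.
  by exists Z' => _; split=> //; split=> // j [<-].
have [nx Hnx] := choice (fun p => next p.1 p.2).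
pose Zs := fix Zs n := if n is n'.+1 then nx (n', Zs n') else X.
have UZ n : U (Zs n) by elim: n => //= n IH; have [] := Hnx (n, Zs n) IH.
have [|Y0 [UY0 HY0]] := pU UZ.
  by move=> n; have [_ []] := Hnx (n, Zs n) (UZ n).
have [Y [UY [YY0 YX]]] := filU UY0 UX.
exists Y; split=> //; split=> // i; exists (W i); split; first by case: (HW i).
apply: bleq_star_trans YY0 _; [exact: fam_block|exact: fam_block|].
have [k Hk] := HY0 (pickle i).+1; exists k.
apply: bleq_trans Hk _; have [_ [_]] := Hnx (pickle i, Zs (pickle i)) (UZ _).
by apply; rewrite pickleK.
Qed.

End Filters.

(** * Perfect trees and fusion *)

Section Trees.
Notation tree := (seq bool -> Prop).
Implicit Types (p q r : tree) (s t u w : seq bool) (f g : nat -> bool).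

Definition subtree q p := forall s, q s -> p s.
Definition comparable_seq s t := prefix s t || prefix t s.
Definition restrict q t : tree := fun s => q s /\ comparable_seq s t.

Lemma subtree_trans r q p : subtree r q -> subtree q p -> subtree r p.
Proof. by move=> rq qp s /rq/qp. Qed.

Lemma restrict_subtree q t : subtree (restrict q t) q.
Proof. by move=> s []. Qed.

Lemma perfect_prefix q s t : is_perfect_tree q -> prefix s t -> q t -> q s.
Proof. by move=> [_ [cl _]] /prefixP[w ->] /cl. Qed.

Lemma perfect_split q s : is_perfect_tree q -> q s ->
  exists u, prefix s u /\ forall b, q (rcons u b).
Proof.
move=> [_ [_ sp]] /sp[w [wf wt]]; exists (s ++ w); split; first exact: prefix_prefix.
by case; rewrite -cats1 -catA.
Qed.

Lemma prefix_le s t w : prefix s w -> prefix t w -> (size s <= size t)%N -> prefix s t.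
Proof.
rewrite !prefixE => /eqP sw /eqP tw st; apply/eqP.
by rewrite -[in LHS]tw take_takel.
Qed.

Lemma prefix_comparable s t w : prefix s w -> prefix t w -> comparable_seq s t.
Proof.
move=> sw tw; rewrite /comparable_seq.
case/orP: (leq_total (size s) (size t)) => le; first by rewrite (prefix_le sw tw le).
by rewrite (prefix_le tw sw le) orbT.
Qed.

Lemma prefix_restrict t u b : prefix t u -> comparable_seq (rcons u b) t.
Proof. by move=> tu; apply/orP; right; apply: prefix_trans tu (prefix_rcons _ _). Qed.

Lemma perfect_restrict q t : is_perfect_tree q -> q t -> is_perfect_tree (restrict q t).
Proof.
move=> pq qt; split; first by exists t; split=> //; rewrite /comparable_seq prefix_refl.
split=> [s u [qsu /orP[st|ts]]|s [qs st]].
- split; first by apply: perfect_prefix qsu => //; apply: prefix_prefix.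
  by rewrite /comparable_seq (prefix_trans (prefix_prefix s u) st).
- split; first by apply: perfect_prefix qsu => //; apply: prefix_prefix.
  exact: prefix_comparable (prefix_prefix s u) ts.
have [w [sw [tw qw]]] : exists w, prefix s w /\ prefix t w /\ q w.
  by case/orP: st => h; [exists t | exists s]; rewrite h prefix_refl.
have [u [wu qu]] := perfect_split pq qw.
have /prefixP[v E] := prefix_trans sw wu.
exists v; rewrite !catA -E !cats1; split; split; rewrite ?qu //;
  by apply: prefix_restrict; rewrite // (prefix_trans tw).
Qed.

Lemma perfect_branch q : is_perfect_tree q -> exists f, branch q f.
Proof.
move=> pq; have ext (s : seq bool) : exists b, q s -> q (rcons s b).
  case: (pselect (q s)) => [qs|]; last by exists true.
  have [u [/prefixP[v ->] qu]] := perfect_split pq qs.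
  case: v qu => [|b v] qu; first by exists true => _; move: (qu true); rewrite cats0.
  exists b => _; apply: (perfect_prefix pq _ (qu true)).
  by rewrite -cat_rcons rcons_cat prefix_prefix.
have [e He] := choice ext.
pose S := fix S n := if n is n'.+1 then rcons (S n') (e (S n')) else [::].
have qS n : q (S n).
  elim: n => [|n IH]; last exact: He.
  by have [[s qs] _] := pq; apply: perfect_prefix qs => //; apply: prefix0s.
exists (fun n => e (S n)) => n.
suff -> : mkseq (fun n => e (S n)) n = S n by [].
by elim: n => //= n IH; rewrite mkseqS IH.
Qed.

Lemma perfect_long q N : is_perfect_tree q -> exists s, q s /\ size s = N.
Proof. by move=> /perfect_branch[f /(_ N) qf]; exists (mkseq f N); rewrite size_mkseq. Qed.

Lemma branch_sub q p f : subtree q p -> branch q f -> branch p f.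
Proof. by move=> qp qf n; apply/qp/qf. Qed.

Lemma mkseq_prefix (T : eqType) (f : nat -> T) m n :
  (m <= n)%N -> prefix (mkseq f m) (mkseq f n).
Proof.
move=> /subnKC<-; elim: (n - m)%N => [|k IH]; first by rewrite addn0 prefix_refl.
by rewrite addnS mkseqS; apply: prefix_trans IH (prefix_rcons _ _).
Qed.

Lemma branch_restrict q f n : branch q f -> branch (restrict q (mkseq f n)) f.
Proof.
move=> qf m; split=> //; rewrite /comparable_seq.
by have [/mkseq_prefix->|/ltnW/mkseq_prefix->] := leqP m n; rewrite ?orbT.
Qed.

Lemma restrict_branch q t f : branch (restrict q t) f -> mkseq f (size t) = t.
Proof.
move=> /(_ (size t))[_]; rewrite /comparable_seq !prefixE size_mkseq take_size.
by rewrite take_oversize ?size_mkseq // eq_sym orbb => /eqP.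
Qed.

Section Fusion.
Variables (Q : seq bool -> tree) (u : seq bool -> seq bool).
Hypothesis perfQ : forall t, is_perfect_tree (Q t).
Hypothesis stepQ : forall t b, subtree (Q (rcons t b)) (restrict (Q t) (rcons (u t) b)).

(** [u t] is the node at which [Q t] is split. That it splits follows from [stepQ], because the
    trees [Q (rcons t b)] are perfect. *)
Definition fuse : tree := fun s => exists t, prefix s (u t).

Lemma fusion_long t b N : exists s, [/\ Q (rcons t b) s, prefix (rcons (u t) b) s & (N <= size s)%N].
Proof.
have [s [Qs sN]] := perfect_long (maxn N (size (u t)).+1) (perfQ (rcons t b)).
exists s; split=> //; last by rewrite sN leq_maxl.
have [_ /orP[|//]] := stepQ Qs; rewrite !prefixE => /eqP E.
by rewrite -E take_takel ?size_rcons ?sN ?leq_maxr // take_oversize // size_rcons.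
Qed.

Lemma fusion_split t b : Q t (rcons (u t) b).
Proof.
have [s [Qs us _]] := fusion_long t b 0.
by apply: perfect_prefix us _ => //; have [] := stepQ Qs.
Qed.

Lemma fusion_node t : Q t (u t).
Proof. exact: perfect_prefix (prefix_rcons _ true) (fusion_split t true). Qed.

(** Otherwise the later splitting node [v] is a proper initial segment of [w]. Long nodes above [v]
    in both directions extend [w], so the bit of [w] after [v] would have both values. *)
Lemma fusion_step t b : prefix (rcons (u t) b) (u (rcons t b)).
Proof.
apply/negPn/negP => np; set w := rcons (u t) b in np *; set v := u (rcons t b) in np *.
have key c : nth false w (size v) = c.
  have [s [Qs vs sN]] := fusion_long (rcons t b) c (size w).
  have ws : prefix w s.
    have [Qs' _] := stepQ Qs; have [_ /orP[|//]] := stepQ Qs'.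
    by rewrite -/w !prefixE => /eqP E; rewrite -E take_takel // take_oversize.
  have lt : (size v < size w)%N.
    rewrite ltnNge; apply: contra np; apply: prefix_le ws _.
    by apply: prefix_trans vs; apply: prefix_rcons.
  move: ws vs => /prefixP[s1 E1] /prefixP[s2 E2].
  have := congr1 (nth false ^~ (size v)) (etrans (esym E1) E2).
  by rewrite nth_cat lt nth_cat size_rcons ltnSn nth_rcons ltnn eqxx.
by have := key true; rewrite (key false).
Qed.

Lemma fusion_sub t t' : prefix t t' -> subtree (Q t') (Q t).
Proof.
move=> /prefixP[w ->]; elim/last_ind: w => [|w b IH]; first by rewrite cats0.
by rewrite -rcons_cat => s /stepQ[/IH].
Qed.

Lemma fusion_nth k t : (k < size t)%N -> prefix (rcons (u (take k t)) (nth false t k)) (u t).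
Proof.
elim/last_ind: t => // t b IH; rewrite size_rcons ltnS => kt.
have -> : take k (rcons t b) = take k t by rewrite -cats1 takel_cat.
move: kt; rewrite nth_rcons leq_eqVlt => /orP[/eqP->|lt].
  by rewrite take_size ltnn eqxx fusion_step.
rewrite lt; apply: prefix_trans (IH lt) (prefix_trans _ (fusion_step t b)).
exact: prefix_rcons.
Qed.

Lemma fusion_inj t t' w : prefix (u t) w -> prefix (u t') w -> size t = size t' -> t = t'.
Proof.
elim/last_ind: t t' => [|t b IH] t'; first by move=> _ _ /esym/size0nil.
case/lastP: t' => [|t' b']; first by rewrite size_rcons.
move=> /(prefix_trans (fusion_step _ _)) tw /(prefix_trans (fusion_step _ _)) tw'.
rewrite !size_rcons => -[/IH]; have := prefix_trans (prefix_rcons _ _) tw.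
have := prefix_trans (prefix_rcons _ _) tw' => h1 h2 /(_ h2 h1) E; subst t'.
move: tw tw'; rewrite !prefixE !size_rcons => /eqP-> /eqP/rcons_inj[->] //.
Qed.

Lemma fuse_perfect : is_perfect_tree fuse.
Proof.
split; first by exists [::], [::]; apply: prefix0s.
split=> [s t [w st]|s [t /prefixP[w E]]].
  by exists w; apply: prefix_trans st; apply: prefix_prefix.
by exists w; rewrite !catA -E !cats1; split; [exists (rcons t false) | exists (rcons t true)];
  apply: fusion_step.
Qed.

Lemma fuse_sub : subtree fuse (Q [::]).
Proof.
move=> s [t st]; apply: (fusion_sub (prefix0s t)).
exact: perfect_prefix st (fusion_node t).
Qed.

(** [n] exceeds the length of [u t] for every [t] of length [k], so a node of length [n] in the
    fusion extends exactly one such [u t]. The level is the same for all branches. *)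
Lemma fuse_level k : exists n, forall s, fuse s -> size s = n ->
  exists t, size t = k /\ subtree (restrict fuse s) (Q t).
Proof.
exists (\max_(t : k.-tuple bool) size (u t)).+1 => s [t' st'] sn.
have bound (t : seq bool) : size t = k -> (size (u t) < size s)%N.
  move=> /eqP tk; rewrite sn ltnS.
  exact: (leq_bigmax (F := fun t : k.-tuple bool => size (u t)) (Tuple tk)).
have long w : (size s <= size (u w))%N -> (k < size w)%N.
  apply: contraTT; rewrite -leqNgt -ltnNge => wk.
  (* A short [w] is padded with [true] to length [k]; the nodes [u] only grow along the padding. *)
  have E : size (w ++ nseq (k - size w) true) = k by rewrite size_cat size_nseq subnKC.
  apply: leq_ltn_trans (bound _ E); apply: size_prefix.
  elim: (k - size w)%N => [|j IH]; first by rewrite cats0 prefix_refl.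
  rewrite -[j.+1]addn1 nseqD catA cats1; apply: prefix_trans IH (prefix_trans _ (fusion_step _ _)).
  exact: prefix_rcons.
have kt' := long _ (size_prefix st').
have sz w : (k < size w)%N -> size (take k w) = k by move=> ?; rewrite size_takel // ltnW.
exists (take k t'); split=> [|s' [[w s'w] ss']]; first exact: sz.
have inQ : Q (take k t') s.
  by apply: (fusion_sub (prefix_take t' k)); apply: perfect_prefix st' (fusion_node t').
case/orP: ss' => ss'; first exact: perfect_prefix ss' inQ.
have kw := long _ (size_prefix (prefix_trans ss' s'w)).
have E : take k w = take k t'.
  apply: (@fusion_inj _ _ (u w)); rewrite ?sz //.
    exact: prefix_trans (prefix_rcons _ _) (fusion_nth kw).
  apply: prefix_trans (prefix_trans ss' s'w).
  apply: prefix_le st' _; last by rewrite ltnW // bound // sz.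
  exact: prefix_trans (prefix_rcons _ _) (fusion_nth kt').
rewrite -E; apply: (fusion_sub (prefix_take w k)).
exact: perfect_prefix s'w (fusion_node w).
Qed.

End Fusion.

(** A fusion: at stage [n] each tree of the level is shrunk to one with the property of code [n], if
    possible; otherwise no perfect subtree has it. Both outcomes pass to the fusion, the first by
    heredity, and [fuse_level] finds the level. *)
Lemma decide (I : countType) (Phi : I -> tree -> Prop) p :
  (forall i q q', is_perfect_tree q' -> subtree q' q -> Phi i q -> Phi i q') ->
  is_perfect_tree p ->
  exists q, [/\ is_perfect_tree q, subtree q p & forall i, exists n, forall f, branch q f ->
    Phi i (restrict q (mkseq f n)) \/
    forall r, is_perfect_tree r -> subtree r (restrict q (mkseq f n)) -> ~ Phi i r].
Proof.
move=> mono pp.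
have dec (n : nat) (r : tree) : exists r' : tree, is_perfect_tree r -> [/\ is_perfect_tree r',
    subtree r' r & forall i, unpickle n = Some i -> Phi i r' \/
      forall r2, is_perfect_tree r2 -> subtree r2 r' -> ~ Phi i r2].
  case En: (unpickle n) => [i|]; last by exists r => pr; split.
  case: (pselect (exists r', [/\ is_perfect_tree r', subtree r' r & Phi i r'])) => [[r' [? ? ?]]|H].
    by exists r'; split=> // _ [<-]; left.
  exists r => pr; split=> // _ [<-]; right=> r2 ? ? ?; apply: H; by exists r2.
have [d Hd] := choice (fun a => dec a.1 a.2).
have spl (r : tree) : exists u, is_perfect_tree r -> forall b, r (rcons u b).
  case: (pselect (is_perfect_tree r)) => [pr|]; last by exists [::].
  have [[s rs] _] := pr; have [u [_ Hu]] := perfect_split pr rs; by exists u.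
have [sp Hsp] := choice spl.
(* trees are built along reversed sequences, so that the recursion is structural *)
pose Qr := fix Qr (t : seq bool) : tree := if t is b :: t' then
   d (size t, restrict (Qr t') (rcons (sp (Qr t')) b)) else d (0%N, p).
have perf t : is_perfect_tree (Qr t).
  elim: t => [|b t IH] /=; first by have [] := Hd (0%N, p) pp.
  have /= := Hd ((size t).+1, restrict (Qr t) (rcons (sp (Qr t)) b)).
  by case=> //; apply: perfect_restrict => //; apply: Hsp.
pose Q t := Qr (rev t); pose u t := sp (Q t).
have pQ t : is_perfect_tree (Q t) by apply: perf.
have stepQ t b : subtree (Q (rcons t b)) (restrict (Q t) (rcons (u t) b)).
  rewrite /Q rev_rcons /=.
  have [] := Hd ((size (rev t)).+1, restrict (Qr (rev t)) (rcons (sp (Qr (rev t))) b)) => //.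
  by apply: perfect_restrict => //; apply: Hsp.
have decQ t i : pickle i = size t -> Phi i (Q t) \/
      forall r2, is_perfect_tree r2 -> subtree r2 (Q t) -> ~ Phi i r2.
  move=> E; have Ei : unpickle (size t) = Some i by rewrite -E pickleK.
  rewrite /Q; move: Ei; rewrite -size_rev; case: (rev t) => [|b w] Ei /=.
    by have [_ _] := Hd (0%N, p) pp; apply.
  have [|_ _] := Hd ((size w).+1, restrict (Qr w) (rcons (sp (Qr w)) b)); last by apply.
  by apply: perfect_restrict => //; apply: Hsp.
have pq := fuse_perfect pQ stepQ.
exists (fuse u); split=> // [|i].
  by apply: subtree_trans (fuse_sub pQ stepQ) _; have [] := Hd (0%N, p) pp.
have [n Hn] := fuse_level pQ stepQ (pickle i); exists n => f qf.
have [|t [tk Ht]] := Hn _ (qf n); first by rewrite size_mkseq.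
have pr : is_perfect_tree (restrict (fuse u) (mkseq f n)) by apply: perfect_restrict.
have [|H|H] := decQ t i; first by [].
  by left; apply: mono Ht H.
by right=> r pr' sr; apply: H => //; apply: subtree_trans Ht.
Qed.

End Trees.

(** * Building members of a strategic filter *)

Section Strategies.
Variable F : countFieldType.
Notation vec := {poly F}.
Implicit Types (X Y Z : nat -> vec) (h : seq vec).

(** A transducer with states in [St] becomes a strategy reading the history of I's moves. The dummy
    [0] is never played, as histories are nonempty. *)
Lemma mealy_strategy (St : Type) (step : St -> (nat -> vec) -> vec * St) (s0 : St) :
  exists alpha : seq (nat -> vec) -> vec, forall Ys, exists st : nat -> St,
    st 0%N = s0 /\ forall k, step (st k) (Ys k) = (G_play_II alpha Ys k, st k.+1).
Proof.
pose run := foldl (fun (a : vec * St) Z => step a.2 Z) (0, s0).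
exists (fun l => (run l).1) => Ys; exists (fun k => (run (mkseq Ys k)).2); split=> // k.
by rewrite /G_play_II mkseqS /run foldl_rcons -surjective_pairing.
Qed.

Lemma outcome_nil (ys : nat -> vec) : outcome [::] ys = ys.
Proof. by apply/funext => n; rewrite /outcome subn0. Qed.

Variable U : (nat -> vec) -> Prop.
Hypothesis stratU : is_strategic U.
Hypothesis filU : is_filter U.
Hypothesis pU : has_p U.

(* A state reached after finitely many moves depends only on the vectors played,
   so only countably many members of the filter are requested along all plays,
   and one [X] in the filter lies below them all modulo tails. *)
Lemma strategic_construction (St : Type) (ok : seq vec -> St -> Prop)
    (nxt : seq vec -> St -> St -> Prop) (c0 : St) :
  ok [::] c0 ->
  (forall h c, ok h c -> exists Y, U Y /\ forall Z, is_block Z -> bleq Z Y ->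
     exists y c', [/\ y != 0, in_span Z y, ok (rcons h y) c' & nxt h c c']) ->
  exists ys cs, [/\ U ys, cs 0%N = c0 &
    forall k, ok (mkseq ys k) (cs k) /\ nxt (mkseq ys k) (cs k) (cs k.+1)].
Proof.
move=> ok0 okS.
(* The successor state is chosen from [h], the state and [y], not from I's move [Z]; hence [st h]
   depends on [h] alone. *)
have pickE (a : seq vec * St * vec) : exists c',
    (exists c'', ok (rcons a.1.1 a.2) c'' /\ nxt a.1.1 a.1.2 c'') ->
    ok (rcons a.1.1 a.2) c' /\ nxt a.1.1 a.1.2 c'.
  case: (pselect (exists c'', ok (rcons a.1.1 a.2) c'' /\ nxt a.1.1 a.1.2 c'')) => [[c'' H]|nH].
    by exists c''.
  by exists c0.
have [pick Hpick] := choice pickE.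
pose run := foldl (fun (a : seq vec * St) y => (rcons a.1 y, pick (a, y))) ([::], c0).
have run1 h : (run h).1 = h.
  by elim/last_ind: h => // h y IH; rewrite /run foldl_rcons /= -/(run h) IH.
pose st h := (run h).2.
have stS h y : st (rcons h y) = pick (h, st h, y).
  by rewrite /st /run foldl_rcons /= -/(run h); have := run1 h; case: (run h) => a c /= ->.
pose P h Y := ok h (st h) -> forall Z, is_block Z -> bleq Z Y ->
  exists y, [/\ y != 0, in_span Z y, ok (rcons h y) (st (rcons h y)) & nxt h (st h) (st (rcons h y))].
have [X0 UX0] : exists X, U X by case: filU => [[_ []]].
have famU := filU.1.
have PE h : exists Y, U Y /\ P h Y.
  case: (pselect (ok h (st h))) => [okh|nok]; last by exists X0; split=> // /nok.
  have [Y [UY HY]] := okS _ _ okh; exists Y; split=> // _ Z bZ /(HY _ bZ)[y [c' [y0 Zy okc nx]]].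
  exists y; rewrite stS; have /= [] := Hpick (h, st h, y); first by exists c'.
  by move=> *; split.
have [X [UX [_ HX]]] := countable_lower_bound filU.1 filU.2 pU UX0 PE.
have bX := fam_block famU UX.
have mvE (a : seq vec * (nat -> vec)) : exists y, ok a.1 (st a.1) -> is_block a.2 -> bleq a.2 X ->
    [/\ y != 0, in_span a.2 y, beyond (maxsize a.1) y, ok (rcons a.1 y) (st (rcons a.1 y))
      & nxt a.1 (st a.1) (st (rcons a.1 y))].
  case: a => h Z /=; case: (pselect (ok h (st h) /\ is_block Z /\ bleq Z X)) => [[okh [bZ ZX]]|H]; last first.
    by exists 0 => *; case: H; split.
  have [W [PW /(bleq_star_beyond bX)[N HN]]] := HX h.
  (* The tail of [Z] starts so late that it lies below [W], which provides the move, and beyond [h],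
     which makes the move legal. *)
  have far v : in_span (tail (maxn N (maxsize h)).+1 Z) v -> beyond (maxn N (maxsize h)) v.
    exact: tail_beyond.
  have ZW : bleq (tail (maxn N (maxsize h)).+1 Z) W.
    move=> v Zv; apply: HN; first by apply/ZX; apply: bleq_tail Zv.
    exact: beyond_le (leq_maxl _ _) (far _ Zv).
  have [y [y0 Zy oky nx]] := PW okh _ (block_tail _ bZ) ZW.
  exists y => _ _ _; split=> //; first exact: bleq_tail Zy.
  exact: beyond_le (leq_maxr _ _) (far _ Zy).
have [mv Hmv] := choice mvE.
have [alpha Ha] := mealy_strategy (fun h Z => (mv (h, Z), rcons h (mv (h, Z)))) [::].
have play Ys : G_legal_I X Ys -> forall k, let h := mkseq (G_play_II alpha Ys) k in
    ok h (st h) /\ [/\ G_play_II alpha Ys k != 0, in_span (Ys k) (G_play_II alpha Ys k),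
      beyond (maxsize h) (G_play_II alpha Ys k), ok (rcons h (G_play_II alpha Ys k)) (st (rcons h (G_play_II alpha Ys k)))
      & nxt h (st h) (st (rcons h (G_play_II alpha Ys k)))].
  move=> leg; have [hs [hs0 hsS]] := Ha Ys.
  have hsE k : hs k = mkseq (G_play_II alpha Ys) k.
    by elim: k => // k IH; rewrite mkseqS -IH; have [<- <-] := hsS k.
  have mvk k : G_play_II alpha Ys k = mv (mkseq (G_play_II alpha Ys) k, Ys k).
    by have [<- _] := hsS k; rewrite -hsE.
  have okk k : ok (mkseq (G_play_II alpha Ys) k) (st (mkseq (G_play_II alpha Ys) k)).
    elim: k => // k IH; rewrite mkseqS mvk.
    by have /= [] := Hmv (mkseq (G_play_II alpha Ys) k, Ys k) IH (leg k).1 (leg k).2.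
  move=> k; split=> //; rewrite mvk.
  exact: (Hmv (mkseq (G_play_II alpha Ys) k, Ys k) (okk k) (leg k).1 (leg k).2).
have [|Ys [leg UYs]] := stratU UX (alpha := alpha).
  move=> Ys leg k; have [_ [? ? far _ _]] := play Ys leg k.
  by split=> //; split=> //; apply: beyond_supp far.
rewrite outcome_nil in UYs.
exists (G_play_II alpha Ys), (fun k => st (mkseq (G_play_II alpha Ys) k)); split=> // k.
by rewrite mkseqS; have [? []] := play Ys leg k.
Qed.

End Strategies.

Lemma mkseq_le (T : Type) (f g : nat -> T) m n : (m <= n)%N ->
  mkseq f n = mkseq g n -> mkseq f m = mkseq g m.
Proof.
move=> /subnKC<-; elim: (n - m)%N => [|k IH]; first by rewrite addn0.
by rewrite addnS !mkseqS => /rcons_inj[/IH].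
Qed.

(** * The parametrized dichotomy *)

Section Dichotomy.
Variable F : countFieldType.
Notation vec := {poly F}.
Notation tree := (seq bool -> Prop).
Implicit Types (X Y Z : nat -> vec) (h : seq vec) (q : tree).
Variable U : (nat -> vec) -> Prop.
Hypothesis stratU : is_strategic U.
Hypothesis filU : is_filter U.
Hypothesis fullU : is_full U.
Hypothesis pU : has_p U.

(** If this failed, below each member of [U] there would be a block sequence whose span has no
    nonzero vector in [C]; fullness puts such a sequence into [U], against density. *)
Lemma full_dense (C : vec -> Prop) :
  (forall Y, U Y -> exists y, [/\ in_span Y y, y != 0 & C y]) ->
  exists Y, U Y /\ forall Z, is_block Z -> bleq Z Y -> exists y, [/\ in_span Z y, y != 0 & C y].
Proof.
move=> dense; apply: contrapT => H.
have [X UX] : exists X, U X by case: filU => [[_ []]].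
have [|Z [UZ [_ HZ]]] := fullU (D := fun v => v != 0 -> ~ C v) UX.
  move=> Y UY _; apply: contrapT => H'; apply: H; exists Y; split=> // Z bZ ZY.
  apply: contrapT => H''; apply: H'; exists Z; split=> //; split=> // v Zv v0 Cv.
  by apply: H''; exists v.
by have [y [Zy y0]] := dense _ UZ; apply: HZ.
Qed.

Lemma bleq_star_tail Z Y W : is_block Y -> is_block Z -> bleq Z Y -> bleq_star Y W ->
  exists k, bleq (tail k Z) W.
Proof. by move=> bY bZ ZY YW; have [k Hk] := bleq_star_trans bY bZ ZY YW; exists k. Qed.

Definition closed_on q (D : (nat -> bool) -> vec -> Prop) :=
  forall v f, (forall n, exists g, [/\ branch q g, mkseq g n = mkseq f n & D g v]) -> D f v.

(* The two coordinates [f] and [Z] are built along one play: [R h t] says that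
   extensions of the vectors [h] and of the initial segment [t] of [f] remain
   dense in the filter. *)
Lemma dense_in_filter q (D : (nat -> bool) -> vec -> Prop) :
  closed_on q D ->
  (forall Y, U Y -> exists Z f, [/\ is_block Z, bleq Z Y, branch q f & forall v, in_span Z v -> D f v]) ->
  exists Z f, [/\ U Z, branch q f & forall v, in_span Z v -> D f v].
Proof.
move=> clD dense.
pose R h t := forall Y, U Y -> exists Z f, [/\ is_block Z, bleq Z Y, branch q f,
   mkseq f (size t) = t & forall u v, fspan h u -> in_span Z v -> D f (u + v)].
have R0 : R [::] [::].
  move=> Y /dense[Z [f [bZ ZY qf ZD]]]; exists Z, f; split=> // u v /fspan_nil-> Zv.
  by rewrite add0r; apply: ZD.
have RS h t : R h t -> exists Y, U Y /\ forall Z, is_block Z -> bleq Z Y ->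
    exists y, [/\ in_span Z y, y != 0 & R (rcons h y) t].
  move=> Rht; apply: full_dense => Y UY; apply: contrapT => H.
  have bad y : exists W, U W /\ (in_span Y y -> y != 0 -> forall Z f, is_block Z -> bleq Z W ->
      branch q f -> mkseq f (size t) = t ->
      ~ forall u v, fspan (rcons h y) u -> in_span Z v -> D f (u + v)).
    case: (pselect (in_span Y y /\ y != 0)) => [[Yy y0]|nY]; last first.
      by exists Y; split=> // Yy y0; case: nY.
    apply: contrapT => nW; apply: H; exists y; split=> // W UW; apply: contrapT => nZ; apply: nW; exists W.
    by split=> // _ _ Z f bZ ZW qf ft HD; apply: nZ; exists Z, f; split.
  (* [W] is almost below all these refutations, one for each [y]. Of the [Z] that [R h t] gives
     below [W], the first vector is a [y] whose refutation fails at a tail of [Z]. *)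
  have [W [UW [WY HW]]] := countable_lower_bound filU.1 filU.2 pU UY bad.
  have [Z [f [bZ ZW qf ft HD]]] := Rht _ UW.
  have [V [HV WV]] := HW (Z 0%N).
  have [k kV] := bleq_star_tail (fam_block filU.1 UW) bZ ZW WV.
  case: (HV _ (bZ.1 0%N) _ _ (block_tail k bZ) kV qf ft).
    by apply/WY/ZW/span_mem.
  move=> u v /fspan_rcons[w [a [hw ->]]] Zv; rewrite -addrA; apply: HD => //.
  by apply: spanD; [apply/spanZ/span_mem | apply: bleq_tail Zv].
have Rb h t : R h t -> exists b, R h (rcons t b).
  move=> Rht; apply: contrapT => H.
  have no b : exists W, U W /\ ~ exists Z f, [/\ is_block Z, bleq Z W, branch q f,
      mkseq f (size (rcons t b)) = rcons t b & forall u v, fspan h u -> in_span Z v -> D f (u + v)].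
    apply: contrapT => H'; apply: H; exists b => Y UY; apply: contrapT => H''.
    by apply: H'; exists Y; split.
  have [W1 [UW1 H1]] := no true; have [W0 [UW0 H0]] := no false.
  have [W [UW [WW1 WW0]]] := filU.2 _ _ UW1 UW0.
  have [Z [f [bZ ZW qf ft HD]]] := Rht _ UW.
  have ft' : mkseq f (size (rcons t (f (size t)))) = rcons t (f (size t)).
    by rewrite size_rcons mkseqS ft.
  case E: (f (size t)) ft' => ft'; [apply: H1|apply: H0]; exists Z, f; split=> //;
    exact: bleq_trans ZW _.
have [||ys [cs [Uys cs0 Hcs]]] := strategic_construction stratU filU pU
    (ok := fun h t => size t = size h /\ R h t) (nxt := fun h t t' => exists b, t' = rcons t b)
    (c0 := [::]).
- by [].
- move=> h t [th /RS[Y [UY HY]]]; exists Y; split=> // Z bZ /(HY _ bZ)[y [Zy y0 /Rb[b Rb']]].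
  by exists y, (rcons t b); split; rewrite ?size_rcons ?th //; exists b.
pose f i := nth false (cs i.+1) i.
have fcs k : mkseq f k = cs k.
  elim: k => [|k IH]; first by rewrite cs0.
  rewrite mkseqS IH /f; have [[sk _] [b ->]] := Hcs k.
  by rewrite nth_rcons sk size_mkseq ltnn eqxx.
have fR k : exists Z g, [/\ branch q g, mkseq g k = mkseq f k &
    forall u v, fspan (mkseq ys k) u -> in_span Z v -> D g (u + v)].
  have [[sk Rk] _] := Hcs k; have [Z [g [_ _ qg gt HD]]] := Rk _ Uys.
  by exists Z, g; split=> //; rewrite fcs -[in RHS]gt sk size_mkseq.
exists ys, f; split=> // [n|v /span_fspan[k Hk]].
  by have [_ [g [qg <- _]]] := fR n; apply: qg.
(* [v] lies in the span of the first [k] vectors, so [R] with [u = v] and zero remainder gives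
   branches [g] near [f] with [D g v]. *)
apply: clD => n; have [Z [g [qg gf HD]]] := fR (maxn n k).
exists g; split=> //; first exact: mkseq_le (leq_maxl n k) gf.
by rewrite -[v]addr0; apply: HD; [apply/Hk/leq_maxr | apply: span0].
Qed.

Lemma parametrized_dichotomy p (D : (nat -> bool) -> vec -> Prop) :
  is_perfect_tree p -> closed_on p D ->
  (exists q Y, [/\ is_perfect_tree q, subtree q p, U Y &
     forall f v, branch q f -> in_span Y v -> D f v]) \/
  (exists q Y, [/\ is_perfect_tree q, subtree q p, U Y &
     forall f Z, branch q f -> is_block Z -> bleq Z Y -> exists v, in_span Z v /\ ~ D f v]).
Proof.
move=> pp clD; apply: contrapT => /not_orP[Ha Hb]; apply: Ha.
(* The invariant of the fusion, maintained at each of its nodes separately. *)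
pose Large h q := forall r, is_perfect_tree r -> subtree r q -> exists Z f,
  [/\ U Z, branch r f & forall u v, fspan h u -> in_span Z v -> D f (u + v)].
have Large_sub h q r : Large h q -> subtree r q -> Large h r.
  by move=> L rq s ps sr; apply: L => //; apply: subtree_trans rq.
(* As the second alternative fails below [p], [dense_in_filter] applies on every perfect [r] and
   yields a [Z] in [U] itself. *)
have L0 : Large [::] p.
  move=> r pr rp; have [||Z [f [UZ rf HZ]]] := @dense_in_filter r D.
  - move=> v f Hf; apply: clD => n; have [g [rg gf Dg]] := Hf n.
    by exists g; split=> //; apply: branch_sub rg.
  - move=> Y UY; apply: contrapT => H; apply: Hb; exists r, Y; split=> // f Z rf bZ ZY.
    apply: contrapT => H'; apply: H; exists Z, f; split=> // v Zv.
    by apply: contrapT => nD; apply: H'; exists v.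
  - by exists Z, f; split=> // u v /fspan_nil-> Zv; rewrite add0r; apply: HZ.
(* Only strings of length [size h] count: a state is the current level of the fusion, and each
   vector moves it down one level. *)
pose ok h (c : seq bool -> tree) := forall t, size t = size h -> is_perfect_tree (c t) /\ Large h (c t).
pose nxt h (c c' : seq bool -> tree) := forall t, size t = size h ->
  exists u, forall b, subtree (c' (rcons t b)) (restrict (c t) (rcons u b)).
have step h c : ok h c -> exists Y, U Y /\ forall Z, is_block Z -> bleq Z Y ->
    exists y, [/\ in_span Z y, y != 0 & forall t, size t = size h ->
      exists r, [/\ is_perfect_tree r, subtree r (c t) & Large (rcons h y) r]].
  move=> okc; apply: full_dense => Y UY; apply: contrapT => H.
  (* Otherwise each [y] in the span of [Y] fails at some node [t], hence is
     excluded by the decided tree [r] at that node; but a single [Z] works at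
     all nodes, and its first vector is such a [y]. *)
  pose Phi y q := forall Z f, U Z -> branch q f ->
    ~ forall u v, fspan (rcons h y) u -> in_span Z v -> D f (u + v).
  have kill (t : (size h).-tuple bool) : exists rZf : tree * (nat -> vec) * (nat -> bool),
      [/\ forall y, (forall r', is_perfect_tree r' -> subtree r' (c t) -> ~ Large (rcons h y) r') ->
            Phi y rZf.1.1, U rZf.1.2, branch rZf.1.1 rZf.2
        & forall u v, fspan h u -> in_span rZf.1.2 v -> D rZf.2 (u + v)].
    have [pc Lc] := okc t (size_tuple t).
    have [|r [pr rc dec]] := decide (Phi := Phi) _ pc.
      by move=> y q q' _ q'q Hq Z f UZ q'f; apply: Hq UZ _; apply: branch_sub q'f.
    have [Z [f [UZ rf HD]]] := Lc _ pr rc.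
    exists (r, Z, f); split=> // y nL Z' f' UZ' rf' HD'.
    have [n /(_ _ rf')[Hn|Hn]] := dec y.
      exact: Hn UZ' (branch_restrict _ rf') HD'.
    apply: nL (perfect_restrict pr (rf' n)) _ _.
      exact: subtree_trans (@restrict_subtree _ _) rc.
    move=> s ps sr; apply: contrapT => nZ; apply: Hn ps sr _ => Z2 f2 UZ2 sf2 HD2.
    by apply: nZ; exists Z2, f2.
  have [rZf HrZf] := choice kill.
  have [|Z [UZ [ZY HZ]]] := @finite_lower_bound _ U filU.2 _ (enum {: (size h).-tuple bool})
      (fun t => (rZf t).1.2) Y UY.
    by move=> t _; case: (HrZf t).
  apply: H; exists (Z 0%N); split; first by apply/ZY/span_mem.
    by have [] := fam_block filU.1 UZ.
  move=> t /eqP th; apply: contrapT => nr; have [Hy _ rf HD] := HrZf (Tuple th).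
  have /(_ Z _ UZ rf) : Phi (Z 0%N) (rZf (Tuple th)).1.1.
    by apply: Hy => r' pr' r'c Lr'; apply: nr; exists r'.
  apply=> u v /fspan_rcons[w [a [hw ->]]] Zv; rewrite -addrA; apply: HD => //.
  apply: HZ; first by rewrite mem_enum.
  by apply: spanD => //; apply/spanZ/span_mem.
have [||ys [cs [Uys cs0 Hcs]]] := strategic_construction stratU filU pU (ok := ok) (nxt := nxt)
    (c0 := fun=> p).
- by [].
- move=> h c /step[Y [UY HY]]; exists Y; split=> // Z bZ /(HY _ bZ)[y [Zy y0 Hy]].
  have ru (t : seq bool) : exists ru : tree * seq bool, size t = size h ->
      [/\ is_perfect_tree ru.1, subtree ru.1 (c t), Large (rcons h y) ru.1
        & forall b, ru.1 (rcons ru.2 b)].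
    case: (pselect (size t = size h)) => [th|]; last by exists (p, [::]).
    have [r [pr rc Lr]] := Hy t th; have [[s rs] _] := pr.
    by have [u [_ Hu]] := perfect_split pr rs; exists (r, u).
  have [f Hf] := choice ru.
  pose c' t := let t' := take (size h) t in
    restrict (f t').1 (rcons (f t').2 (nth false t (size h))).
  exists y, c'; split=> //.
    move=> t; rewrite size_rcons => th.
    have th' : size (take (size h) t) = size h by rewrite size_takel // th.
    have [pr rc Lr Hu] := Hf _ th'; split; first exact: perfect_restrict.
    by apply: Large_sub Lr _; apply: restrict_subtree.
  move=> t th; exists (f t).2 => b s.
  rewrite /c' -th -cats1 take_size_cat // nth_cat ltnn subnn /= => -[rs cmp]; split=> //.
  by have [_ rc _ _] := Hf _ th; apply: rc.
pose Q t := cs (size t) t.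
have okQ t : is_perfect_tree (Q t) /\ Large (mkseq ys (size t)) (Q t).
  by have [okc _] := Hcs (size t); apply: okc; rewrite size_mkseq.
have uE t : exists u, forall b, subtree (Q (rcons t b)) (restrict (Q t) (rcons u b)).
  have [_ nx] := Hcs (size t); have [|u Hu] := nx t; first by rewrite size_mkseq.
  by exists u => b; rewrite /Q size_rcons.
have [u Hu] := choice uE.
have pQ t : is_perfect_tree (Q t) := (okQ t).1.
have pq := fuse_perfect pQ Hu.
exists (fuse u), ys; split=> //.
  by apply: subtree_trans (fuse_sub pQ Hu) _; rewrite /Q cs0.
move=> f v qf /span_fspan[k Hk]; apply: clD => n.
have [m Hm] := fuse_level pQ Hu k.
have [|t [tk Ht]] := Hm _ (qf m); first by rewrite size_mkseq.
(* Restricting at length [maxn n m] gives both agreement with [f] up to [n] and containment in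
   [Q t], which is large for the first [k] vectors; their span contains [v]. *)
have sm : subtree (restrict (fuse u) (mkseq f (maxn n m))) (Q t).
  move=> s [qs cmp]; case/orP: cmp => cmp.
    apply: (perfect_prefix (pQ t) cmp); apply: Ht; split; first exact: qf.
    by apply/orP; right; rewrite mkseq_prefix ?leq_maxr.
  apply: Ht; split=> //; apply/orP; right; apply: prefix_trans cmp.
  by rewrite mkseq_prefix ?leq_maxr.
have [Z [g [UZ rg HD]]] := (okQ t).2 _ (perfect_restrict pq (qf (maxn n m))) sm.
have gf := restrict_branch rg; rewrite size_mkseq in gf.
exists g; split.
- by apply: branch_sub rg; apply: subtree_trans sm _; apply: subtree_trans (fusion_sub Hu (prefix0s t)) _; rewrite /Q cs0.
- exact: mkseq_le (leq_maxl n m) gf.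
- rewrite -[v]addr0; apply: HD; last exact: span0.
  by apply: Hk; rewrite tk.
Qed.

End Dichotomy.

(** * Borel sets as projections of closed sets *)

Section Suslin.
Variable F : countFieldType.
Implicit Types (A : point F -> Prop) (z w : point F) (g : nat -> nat).

Definition is_closed (C : point F -> (nat -> nat) -> Prop) :=
  forall z g, (forall n, exists w g', [/\ cyl n z w, forall i, (i < n)%N -> g' i = g i & C w g']) ->
    C z g.

Definition suslin A := exists C, is_closed C /\ forall z, A z <-> exists g, C z g.

Lemma cyl_le m n z w : (m <= n)%N -> cyl n z w -> cyl m z w.
Proof. by move=> mn H i im; apply: H; apply: leq_trans mn. Qed.

Lemma cyl_sym n z w : cyl n z w -> cyl n w z.
Proof. by move=> H i /H[-> ->]. Qed.

Lemma cyl_trans n z w v : cyl n z w -> cyl n w v -> cyl n z v.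
Proof. by move=> H1 H2 i lt; have [<- <-] := H1 _ lt; apply: H2. Qed.

(** [g 0] records the length of a cylinder around [z] inside [A]. For a fixed value the condition
    depends on [z] only up to [g 0], hence is closed; agreement up to [(g 0).+1] also fixes
    [g 0]. *)
Lemma suslin_open A : is_open A -> suslin A.
Proof.
move=> opA; exists (fun z g => forall w, cyl (g 0%N) z w -> A w); split=> [z g H|z].
  move=> w zw; have [z' [g' [zz' gg' HC]]] := H (g 0%N).+1; apply: HC.
  rewrite gg' //; apply: cyl_trans zw; apply: cyl_sym; exact: cyl_le zz'.
split=> [/opA[n Hn]|[g]]; first by exists (fun=> n).
by apply.
Qed.

Lemma suslin_closed A : is_open A -> suslin (fun z => ~ A z).
Proof.
move=> opA; exists (fun z _ => ~ A z); split=> [z g H /opA[n Hn]|z]; last first.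
  by split=> [nA|[]//]; exists (fun=> 0%N).
by have [w [g' [zw _]]] := H n; apply; apply: Hn.
Qed.

Lemma suslin_union (A : nat -> point F -> Prop) :
  (forall n, suslin (A n)) -> suslin (fun z => exists n, A n z).
Proof.
move=> /choice[C HC]; exists (fun z g => C (g 0%N) z (fun n => g n.+1)); split=> [z g H|z].
  apply: (HC _).1 => n; have [w [g' [zw gg' Cw]]] := H n.+1.
  exists w, (fun n => g' n.+1); split; first exact: cyl_le zw.
    by move=> i lt; apply: gg'.
  by rewrite -gg'.
split=> [[n /(HC n).2[g Cg]]|[g Cg]].
  by exists (fun k => if k is k'.+1 then g k' else n).
by exists (g 0%N); apply/(HC _).2; exists (fun n => g n.+1).
Qed.

(** One [g] codes witnesses for all [n], the one for [n] along the pairs [(n, k)]. Agreement up to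
    the maximum in the proof fixes its first [m] values. *)
Lemma suslin_inter (A : nat -> point F -> Prop) :
  (forall n, suslin (A n)) -> suslin (fun z => forall n, A n z).
Proof.
move=> /choice[C HC].
exists (fun z g => forall n, C n z (fun k => g (pickle (n, k)))); split=> [z g H n|z].
  apply: (HC _).1 => m.
  have [w [g' [zw gg' Cw]]] := H (maxn m (\max_(k < m) (pickle (n, k : nat)).+1)).
  exists w, (fun k => g' (pickle (n, k))); split=> [|i im|//].
    exact: cyl_le (leq_maxl _ _) zw.
  apply: gg'; rewrite leq_max; apply/orP; right.
  exact: (leq_bigmax (F := fun k : 'I_m => (pickle (n, k : nat)).+1) (Ordinal im)).
split=> [Hz|[g Cg] n]; last by apply/(HC _).2; exists (fun k => g (pickle (n, k))).
have [G HG] := choice (fun n => ((HC n).2 z).1 (Hz n)).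
exists (fun k => if unpickle k is Some (n, m) then G n m else 0%N) => n.
suff -> : (fun k => if unpickle (pickle (n, k)) is Some (n0, m) then G n0 m else 0%N) = G n by [].
by apply/funext => k; rewrite pickleK.
Qed.

Lemma suslin_ext A B : (forall z, A z <-> B z) -> suslin A -> suslin B.
Proof. by move=> E [C [clC HC]]; exists C; split=> // z; rewrite -E. Qed.

(** The induction carries complements along, so that the complement of a union is an intersection of
    sets already treated. *)
Lemma Borel_suslin A : Borel A -> suslin A /\ suslin (fun z => ~ A z).
Proof.
elim=> {A} [A opA|A _ [sA sC]|A _ IH|A B _ [sA sC] E].
- by split; [apply: suslin_open | apply: suslin_closed].
- by split=> //; apply: suslin_ext sA => z; rewrite not_notP.
- split; first by apply: suslin_union => n; case: (IH n).
  apply: (@suslin_ext (fun z => forall n, ~ A n z)) => [z|]; first by rewrite forallNP.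
  by apply: suslin_inter => n; case: (IH n).
- by split; [apply: suslin_ext sA | apply: suslin_ext sC => z; rewrite E].
Qed.

End Suslin.

(** * From reachability to strategies of II *)

Section Reach.
Variable F : countFieldType.
Notation vec := {poly F}.
Implicit Types (X Y Z : nat -> vec) (x : seq vec) (s : seq nat).
Variable Bad : seq vec -> seq nat -> Prop.

Definition legal_move Y x (mv : (nat -> vec) -> vec) := forall Z, is_block Z -> bleq Z Y ->
  [/\ mv Z != 0, in_span Z (mv Z) & forall u, u \in x -> supp_before u (mv Z)].

(* [j] counts the vectors played since [s] was last extended; after [j.+1] of
   them II may append the integer [j], so that II can append any integer by
   waiting, but must play at least one vector in between. *)
Inductive reach Y s : seq vec -> nat -> Prop :=
| reach_done x j : Bad x (rcons s j) -> reach Y s x j.+1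
| reach_step x j mv : legal_move Y x mv ->
    (forall Z, is_block Z -> bleq Z Y -> reach Y s (rcons x (mv Z)) j.+1) -> reach Y s x j.

(** II replies to [Z] as if I had played a tail of [Z] so far out that it lies below [Y]. *)
Lemma reach_star Y Y' s x j : is_block Y' -> bleq_star Y' Y -> reach Y s x j -> reach Y' s x j.
Proof.
move=> bY' /(bleq_star_beyond bY')[N HN].
have tl Z : is_block Z -> bleq Z Y' -> bleq (tail N.+1 Z) Y.
  move=> bZ ZY' v Zv; apply: HN; first by apply/ZY'; apply: bleq_tail Zv.
  exact: tail_beyond Zv.
elim=> {x j} [x j bad|x j mv leg _ IH]; first exact: reach_done.
apply: (@reach_step _ _ _ _ (fun Z => mv (tail N.+1 Z))) => Z bZ ZY'.
  have [? Zm ?] := leg _ (block_tail N.+1 bZ) (tl _ bZ ZY').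
  by split=> //; apply: bleq_tail Zm.
exact: IH (block_tail N.+1 bZ) (tl _ bZ ZY').
Qed.

Inductive plan := Stop | Move of ((nat -> vec) -> vec) & ((nat -> vec) -> plan).

(* Plans are kept as data because the eventual strategy must follow one fixed
   well-founded plan; choosing a [reach]-preserving move at each turn need not
   terminate. *)
Fixpoint valid Y s (T : plan) x j : Prop := match T with
  | Stop => exists i, j = i.+1 /\ Bad x (rcons s i)
  | Move mv next => legal_move Y x mv /\
      forall Z, is_block Z -> bleq Z Y -> valid Y s (next Z) (rcons x (mv Z)) j.+1
  end.

Lemma reach_plan Y s x j : reach Y s x j -> exists T, valid Y s T x j.
Proof.
elim=> {x j} [x j bad|x j mv leg _ IH]; first by exists Stop, j.
have IH' Z : exists T, is_block Z -> bleq Z Y -> valid Y s T (rcons x (mv Z)) j.+1.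
  case: (pselect (is_block Z /\ bleq Z Y)) => [[bZ ZY]|H].
    by have [T HT] := IH Z bZ ZY; exists T.
  by exists Stop => bZ ZY; case: H.
by have [next Hn] := choice IH'; exists (Move mv next).
Qed.

(** II follows a valid plan to its end, extends [s], and starts the plan of the new bad position.
    Plans are well-founded, so this happens infinitely often and the extensions converge to [g]. *)
Lemma reach_strategy Y x0 : (forall x s, Bad x s -> reach Y s x 0) -> Bad x0 [::] ->
  exists alpha, is_strategy_II_G x0 Y alpha /\ forall Ys, G_legal_I Y Ys ->
    exists g : nat -> nat, forall n, exists k s, [/\ (n <= k)%N, (n <= size s)%N,
      Bad (x0 ++ mkseq (G_play_II alpha Ys) k) s & forall i, (i < size s)%N -> nth 0%N s i = g i].
Proof.
move=> HR bad0.
have TE (a : seq vec * seq nat) : exists T, Bad a.1 a.2 -> valid Y a.2 T a.1 0.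
  case: (pselect (Bad a.1 a.2)) => [/HR/reach_plan[T HT]|nB]; first by exists T.
  by exists Stop => /nB.
have [T0 HT0] := choice TE.
pose state := (seq vec * seq nat * nat * plan)%type.
(* [j.-1] is the integer that the finished plan appends. The new plan starts at counter [0], where
   [Stop] is not valid, so one replacement suffices to reach a [Move]. *)
pose norm (st : state) : state := let: (x, s, j, T) := st in
  if T is Stop then (x, rcons s j.-1, 0%N, T0 (x, rcons s j.-1)) else st.
pose step (st : state) Z : vec * state := let: (x, s, j, T) := norm st in
  if T is Move mv next then (mv Z, (rcons x (mv Z), s, j.+1, next Z)) else (0, st).
pose good x (st : state) := st.1.1.1 = x /\ valid Y st.1.1.2 st.2 st.1.1.1 st.1.2.
have stepP x st Z : good x st -> is_block Z -> bleq Z Y -> let y := (step st Z).1 in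
    [/\ [/\ y != 0, in_span Z y & forall u, u \in x -> supp_before u y],
      good (rcons x y) (step st Z).2 &
      match st.2 with
      | Move _ next => (step st Z).2.1.1.2 = st.1.1.2 /\ (step st Z).2.2 = next Z
      | Stop => exists i, (step st Z).2.1.1.2 = rcons st.1.1.2 i /\ Bad x (rcons st.1.1.2 i)
      end].
  case: st => [[[x' s] j] T] [/= -> {x'}] vT bZ ZY.
  case: T vT => [[i [-> /= bad]]|mv next [leg vn]]; last first.
    by rewrite /step /=; split=> //=; [apply: leg | split=> //; apply: vn].
  rewrite /step /=; have /= := HT0 (x, rcons s i) bad.
  case: (T0 _) => [[k []//]|mv next [leg vn]] /=.
  by split; [apply: leg | split=> //; apply: vn | exists i].
have [alpha Ha] := mealy_strategy step (x0, [::], 0%N, T0 (x0, [::])).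
have run Ys : G_legal_I Y Ys -> exists st : nat -> state, st 0%N = (x0, [::], 0%N, T0 (x0, [::])) /\
    forall k, [/\ step (st k) (Ys k) = (G_play_II alpha Ys k, st k.+1) &
      good (x0 ++ mkseq (G_play_II alpha Ys) k) (st k)].
  move=> leg; have [st [st0 stS]] := Ha Ys; exists st; split=> // k; split=> //.
  elim: k => [|k IH]; first by rewrite st0 cats0; split=> //; apply: (HT0 (x0, [::])).
  have [bZ ZY] := leg k; have [_] := stepP _ _ _ IH bZ ZY.
  by rewrite stS /= mkseqS rcons_cat.
exists alpha; split=> Ys leg.
  move=> k; have [st [_ /(_ k)[stS gd]]] := run Ys leg; have [bZ ZY] := leg k.
  by have [] := stepP _ _ _ gd bZ ZY; rewrite stS /= => -[].
have [st [st0 stH]] := run Ys leg.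
have stepE k : match (st k).2 with
    | Move _ next => (st k.+1).1.1.2 = (st k).1.1.2 /\ (st k.+1).2 = next (Ys k)
    | Stop => exists i, (st k.+1).1.1.2 = rcons (st k).1.1.2 i /\
        Bad (x0 ++ mkseq (G_play_II alpha Ys) k) (rcons (st k).1.1.2 i)
    end.
  have [stS gd] := stH k; have [bZ ZY] := leg k.
  have [_ _] := stepP _ _ _ gd bZ ZY; rewrite stS.
  by case: ((st k).2) => [|mv next].
pose w k := (st k).1.1.2.
have w_prefix k m : (k <= m)%N -> prefix (w k) (w m).
  move=> /subnKC<-; elim: (m - k)%N => [|d IH]; first by rewrite addn0 prefix_refl.
  apply: prefix_trans IH _; rewrite addnS; have := stepE (k + d)%N.
  case: ((st (k + d)%N).2) => [[i [E _]]|mv next [E _]]; rewrite /w E ?prefix_rcons //.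
  exact: prefix_refl.
(* Well-foundedness enters here, as induction on the plan in force at time [k]. *)
have stops k : exists m, (k <= m)%N /\ (st m).2 = Stop.
  have [T] : exists T, (st k).2 = T by exists (st k).2.
  elim: T k => [|mv next IH] k E; first by exists k.
  have := stepE k; rewrite E => -[_ /IH[m [km Em]]].
  by exists m; split=> //; apply: ltnW.
have events n : exists k i, [/\ (n <= k)%N, (n <= size (w k))%N, w k.+1 = rcons (w k) i &
    Bad (x0 ++ mkseq (G_play_II alpha Ys) k) (rcons (w k) i)].
  elim: n => [|n [K [i0 [nK nw EK _]]]].
    by have [k [_ E]] := stops 0%N; have := stepE k; rewrite E => -[i [? ?]]; exists k, i.
  have [k [kK E]] := stops K.+1; have := stepE k; rewrite E => -[i [? ?]]; exists k, i.
  split=> //; first exact: leq_trans kK.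
  by apply: leq_trans (size_prefix (w_prefix _ _ kK)); rewrite EK size_rcons.
have longE i : exists k, (i < size (w k))%N.
  by have [k [_ [_ lt _ _]]] := events i.+1; exists k.
have [K HK] := choice longE.
have gE k i : (i < size (w k))%N -> nth 0%N (w k) i = nth 0%N (w (K i)) i.
  move=> lt; case/orP: (leq_total k (K i)) => /w_prefix/prefixP[v ->]; rewrite nth_cat ?lt ?HK //.
exists (fun i => nth 0%N (w (K i)) i) => n; have [k [i [nk nw E bad]]] := events n.
exists k, (rcons (w k) i); split=> //; first by rewrite size_rcons leqW.
by rewrite -E => i'; apply: gE.
Qed.

End Reach.

(** Turns bounds depending on the first [n] bits of a branch into one for all branches, as I needs a
    single strategy for the whole tree. *)
Definition level_max n (g : seq bool -> nat) := \max_(t : n.-tuple bool) g t.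

Lemma leq_level_max n (g : seq bool -> nat) t : size t = n -> (g t <= level_max n g)%N.
Proof.
by move=> /eqP tn; apply: (leq_bigmax (F := fun t : n.-tuple bool => g t) (Tuple tn)).
Qed.

Lemma mkseq_addn (T : Type) (f : nat -> T) m n :
  mkseq f (n + m) = mkseq f m ++ mkseq (fun i => f (i + m)%N) n.
Proof. by elim: n => [|n IH]; rewrite ?cats0 // addSn !mkseqS IH rcons_cat. Qed.

Lemma restrict_le q (f : nat -> bool) m n :
  (m <= n)%N -> subtree (restrict q (mkseq f n)) (restrict q (mkseq f m)).
Proof.
move=> mn s [qs /orP[sn|ns]]; split=> //.
  exact: prefix_comparable sn (mkseq_prefix f mn).
by apply/orP; right; apply: prefix_trans ns; apply: mkseq_prefix.
Qed.

Lemma restrict_mono q p t : subtree q p -> subtree (restrict q t) (restrict p t).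
Proof. by move=> qp s [/qp ps st]; split. Qed.

(** * The main argument *)

Section Main.
Variable F : countFieldType.
Notation vec := {poly F}.
Notation tree := (seq bool -> Prop).
Implicit Types (X Y Z : nat -> vec) (x h : seq vec) (q r : tree) (f : nat -> bool) (s : seq nat).

Lemma F_follows_weaken x Y Y' sigma sigma' N (ys : nat -> vec) :
  (forall v, in_span Y v -> beyond N v -> in_span Y' v) ->
  (forall k, (N <= sigma (mkseq ys k))%N) ->
  (forall k, (sigma' (mkseq ys k) <= sigma (mkseq ys k))%N) ->
  F_follows x Y sigma ys -> F_follows x Y' sigma' ys.
Proof.
move=> YY' Ns ss H k; have [y0 [Yy [far blk]]] := H k.
split=> //; split; first by apply: YY' Yy _ => i /far; apply: leq_ltn_trans.
by split=> // i /far; apply: leq_ltn_trans.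
Qed.

Lemma F_follows_shift x Y sigma sigma' (ys : nat -> vec) j :
  (forall k, (sigma' (mkseq (fun i => ys (i + j)%N) k) <= sigma (mkseq ys (k + j)))%N) ->
  F_follows x Y sigma ys ->
  F_follows (x ++ mkseq ys j) Y sigma' (fun k => ys (k + j)%N).
Proof.
move=> ss H k; have [y0 [Yy [far blk]]] := H (k + j)%N.
split=> //; split=> //; split; first by move=> i /far; apply: leq_ltn_trans.
by move=> u; rewrite -catA -mkseq_addn; apply: blk.
Qed.

Lemma outcome_shift x (ys : nat -> vec) j :
  outcome (x ++ mkseq ys j) (fun k => ys (k + j)%N) = outcome x ys.
Proof.
apply/funext => n; rewrite /outcome size_cat size_mkseq nth_cat.
have [nx|xn] := ltnP n (size x); first by rewrite ltn_addr.
rewrite -ltn_subLR //; case: ltnP => h; first by rewrite nth_mkseq.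
by rewrite subnDA subnK.
Qed.

Variable U : (nat -> vec) -> Prop.
Hypothesis stratU : is_strategic U.
Hypothesis filU : is_filter U.
Hypothesis fullU : is_full U.
Hypothesis pU : has_p U.
Variables (A : point F -> Prop) (C : point F -> (nat -> nat) -> Prop).
Hypothesis clC : is_closed C.
Hypothesis AC : forall z, A z <-> exists g, C z g.

Definition piece s z := exists g, (forall i, (i < size s)%N -> g i = nth 0%N s i) /\ C z g.

(* Quantifying [Y] existentially makes this a property of the tree alone; since
   [U] is a filter and tails are irrelevant, nothing is lost. *)
Definition Good (e : seq vec * seq nat) q := exists Y, U Y /\ exists sigma, forall f ys,
  branch q f -> F_follows e.1 Y sigma ys -> ~ piece e.2 (f, outcome e.1 ys).

Lemma perfectly_ramsey : perfectly_strategically_Ramsey U A.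
Proof.
move=> x X p _ UX pp; have famU := filU.1.
case: (pselect (exists q, [/\ is_perfect_tree q, subtree q p & Good (x, [::]) q])).
  move=> [q [pq qp [Y [UY [sigma Hs]]]]].
  have [Z [UZ [ZX ZY]]] := filU.2 _ _ UX UY.
  exists Z, q; do 4!split=> //; left; exists sigma => f ys qf fol /AC[g Cg].
  apply: (Hs f ys) => //; last by exists g.
  by apply: (F_follows_weaken (N := 0%N)) fol => // v /ZY.
move=> notGood.
have [|q1 [pq1 q1p dec1]] := decide (Phi := Good) _ pp.
  move=> e q q' _ q'q [Y [UY [sigma Hs]]]; exists Y; split=> //; exists sigma => f ys q'f.
  by apply: Hs; apply: branch_sub q'f.
have [l1 Hl1] := choice dec1.
(* [gd e f] depends only on [f] up to [l1 e], and by [gdP] it follows from goodness at any perfect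
   tree below that node; [w] and [wP] repeat this for [W]. *)
pose gd e f := Good e (restrict q1 (mkseq f (l1 e))).
have gdP e f r : branch q1 f -> is_perfect_tree r -> subtree r (restrict q1 (mkseq f (l1 e))) ->
    Good e r -> gd e f.
  by move=> qf pr sr Gr; case: (Hl1 e f qf) => // /(_ r pr sr).
pose Bad f x' s := ~ gd (x', s) f.
(* One [Y] must serve all branches of [q], while II's moves may depend on the branch. *)
pose W (d : seq vec * seq nat * nat) q := exists Y, U Y /\ forall f, branch q f ->
  reach (Bad f) Y d.1.2 d.1.1 d.2.
have [|q2 [pq2 q2q1 dec2]] := decide (Phi := W) _ pq1.
  move=> d q q' _ q'q [Y [UY HY]]; exists Y; split=> // f q'f.
  by apply: HY; apply: branch_sub q'f.
have [l2 Hl2] := choice dec2.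
pose w d f := W d (restrict q2 (mkseq f (l2 d))).
have wP d f r : branch q2 f -> is_perfect_tree r -> subtree r (restrict q2 (mkseq f (l2 d))) ->
    W d r -> w d f.
  by move=> qf pr sr Wr; case: (Hl2 d f qf) => // /(_ r pr sr).
pose Phi (d : seq vec * seq nat * nat) q := exists Y, U Y /\ forall f y, branch q f ->
  in_span Y y -> y != 0 -> beyond (maxsize d.1.1) y -> ~ w (rcons d.1.1 y, d.1.2, d.2.+1) f.
have PhiS d q q' : is_perfect_tree q' -> subtree q' q -> Phi d q -> Phi d q'.
  move=> _ q'q [Y [UY HY]]; exists Y; split=> // f y q'f.
  by apply: HY; apply: branch_sub q'f.
have [q3 [pq3 q3q2 dec3]] := decide PhiS pq2.
have [l3 Hl3] := choice dec3.
have WE (a : seq vec * seq nat * nat * seq bool) : exists Y, U Y /\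
    (W a.1 (restrict q2 a.2) -> forall f, branch (restrict q2 a.2) f ->
       reach (Bad f) Y a.1.1.2 a.1.1.1 a.1.2).
  case: (pselect (W a.1 (restrict q2 a.2))) => [[Y [UY HY]]|nW]; first by exists Y.
  by exists X; split=> // /nW.
have w_reach Y d f : U Y -> (forall a, exists V, (W a.1 (restrict q2 a.2) ->
      forall f, branch (restrict q2 a.2) f -> reach (Bad f) V a.1.1.2 a.1.1.1 a.1.2) /\ bleq_star Y V) ->
    branch q2 f -> w d f -> reach (Bad f) Y d.1.2 d.1.1 d.2.
  move=> UY HY qf wd; have [V [HV YV]] := HY (d, mkseq f (l2 d)).
  apply: reach_star (fam_block famU UY) YV _.
  by apply: (HV wd); apply: branch_restrict.
(* If the second alternative of the dichotomy holds, II has a first move into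
   the set of vectors from which it can already reach a bad position. *)
have dense d r : is_perfect_tree r -> subtree r q2 ->
    exists r', [/\ is_perfect_tree r', subtree r' r & Phi d r' \/ W d r'].
  move=> pr rq2; pose d' y : seq vec * seq nat * nat := (rcons d.1.1 y, d.1.2, d.2.+1).
  have [|[q [Y [pq qr UY HY]]]|[q [Y [pq qr UY HY]]]] := parametrized_dichotomy stratU filU fullU pU
    (D := fun f y => y != 0 -> beyond (maxsize d.1.1) y -> ~ w (d' y) f) pr.
  (* For fixed [v] the condition depends on [f] only up to [l2 (d' v)], hence is closed. *)
  - move=> v f Hf v0 far; have [g [_ gf]] := Hf (l2 (d' v)).
    by rewrite /w gf; apply.
  - exists q; split=> //; left; exists Y; split=> // f y qf Yy; exact: HY.
  exists q; split=> //; right.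
  have [Y' [UY' [Y'Y HY']]] := countable_lower_bound filU.1 filU.2 pU UY WE.
  exists Y'; split=> // f qf.
  have qf2 : branch q2 f by apply: branch_sub qf; apply: subtree_trans qr rq2.
  have mvE Z : exists y, is_block Z -> bleq Z Y' ->
      [/\ in_span Z y, y != 0, beyond (maxsize d.1.1) y & w (d' y) f].
    case: (pselect (is_block Z /\ bleq Z Y')) => [[bZ ZY']|H]; last first.
      by exists 0 => bZ ZY'; case: H.
    have [y [Zy nD]] := HY f Z qf bZ (bleq_trans ZY' Y'Y).
    exists y => _ _; split=> //.
    - by apply/negP => /eqP y0; apply: nD; rewrite y0 eqxx.
    - by apply: contrapT => nb; apply: nD.
    - by apply: contrapT => nw; apply: nD.
  have [mv Hmv] := choice mvE.
  apply: (@reach_step _ _ _ _ _ _ mv) => Z bZ ZY'; have [Zy y0 far wy] := Hmv Z bZ ZY'.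
    by split=> //; apply: beyond_supp far.
  exact: (w_reach Y' (d' (mv Z)) f).
pose l d := maxn (l2 d) (l3 d).
(* When [w d f] fails, [dense] can only produce [Phi], since a subtree with [W d] would give [w d f]
   by [wP]. *)
have star d f : branch q3 f -> ~ w d f -> Phi d (restrict q3 (mkseq f (l d))).
  move=> qf nw; have pr := perfect_restrict pq3 (qf (l d)).
  have sr3 := @restrict_le q3 f _ _ (leq_maxr (l2 d) (l3 d)).
  case: (Hl3 d f qf) => [|nPhi]; first exact: PhiS.
  have [|r' [pr' sr' [Phir|Wr]]] := dense d _ pr; first exact: subtree_trans (@restrict_subtree _ _) q3q2.
    by case: (nPhi r' pr') => //; apply: subtree_trans sr3.
  case: nw; apply: wP Wr => //; first exact: branch_sub qf.
  apply: subtree_trans sr' _; apply: subtree_trans (restrict_mono q3q2) _.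
  exact: restrict_le (leq_maxl _ _).
have GE (a : seq vec * seq nat * seq bool) : exists Y, U Y /\ (Good a.1 (restrict q1 a.2) ->
    exists sigma, forall f ys, branch (restrict q1 a.2) f -> F_follows a.1.1 Y sigma ys ->
      ~ piece a.1.2 (f, outcome a.1.1 ys)).
  case: (pselect (Good a.1 (restrict q1 a.2))) => [[Y [UY HY]]|nG]; first by exists Y.
  by exists X; split=> // /nG.
have PE (a : seq vec * seq nat * nat * seq bool) : exists Y, U Y /\ (Phi a.1 (restrict q3 a.2) ->
    forall f y, branch (restrict q3 a.2) f -> in_span Y y -> y != 0 ->
      beyond (maxsize a.1.1.1) y -> ~ w (rcons a.1.1.1 y, a.1.1.2, a.1.2.+1) f).
  case: (pselect (Phi a.1 (restrict q3 a.2))) => [[Y [UY HY]]|nP]; first by exists Y.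
  by exists X; split=> // /nP.
(* Three diagonalisations: over the strategies of I, the reachability witnesses for II, and the
   witnesses of [Phi]. *)
have [Y1 [UY1 [Y1X HY1]]] := countable_lower_bound filU.1 filU.2 pU UX GE.
have [Y2 [UY2 [Y2Y1 HY2]]] := countable_lower_bound filU.1 filU.2 pU UY1 WE.
have [Y [UY [YY2 HY3]]] := countable_lower_bound filU.1 filU.2 pU UY2 PE.
have bY := fam_block famU UY.
have YY1 := bleq_trans YY2 Y2Y1.
(* Only finitely many nodes have length [l1 e]; the maximum of their strategies serves all branches
   at once. [NE] treats the bounds from [Phi] likewise. *)
have tauE e : exists tau, forall f, branch q1 f -> gd e f -> forall ys,
    F_follows e.1 Y tau ys -> ~ piece e.2 (f, outcome e.1 ys).
  have loc t : exists a : nat * (seq vec -> nat), Good e (restrict q1 t) -> forall f ys,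
      branch (restrict q1 t) f -> F_follows e.1 Y (fun h => maxn a.1 (a.2 h)) ys ->
      ~ piece e.2 (f, outcome e.1 ys).
    case: (pselect (Good e (restrict q1 t))) => [Gt|nG]; last by exists (0%N, fun=> 0%N).
    have [V [/(_ Gt)[sigma Hs] Y1V]] := HY1 (e, t).
    have YV := bleq_star_trans (fam_block famU UY1) bY YY1 Y1V.
    have [N HN] := bleq_star_beyond bY YV.
    exists (N, sigma) => _ f ys qf fol; apply: Hs => //.
    by apply: F_follows_weaken HN _ _ fol => k; rewrite ?leq_maxl ?leq_maxr.
  have [a Ha] := choice loc.
  exists (fun h => level_max (l1 e) (fun t => maxn (a t).1 ((a t).2 h))) => f qf gf ys fol.
  apply: (Ha _ gf) => //; first exact: branch_restrict.
  apply: (F_follows_weaken (N := 0%N)) fol => // k.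
  by apply: (leq_level_max (fun t => maxn (a t).1 ((a t).2 _))); rewrite size_mkseq.
have [tau Htau] := choice tauE.
have NE (d : seq vec * seq nat * nat) : exists N, forall f, branch q3 f -> ~ w d f -> forall y, in_span Y y -> y != 0 ->
    beyond N y -> ~ w (rcons d.1.1 y, d.1.2, d.2.+1) f.
  have loc t : exists N, Phi d (restrict q3 t) -> forall f y, branch (restrict q3 t) f ->
      in_span Y y -> y != 0 -> beyond N y -> ~ w (rcons d.1.1 y, d.1.2, d.2.+1) f.
    have [V [HV YV]] := HY3 (d, t).
    have [N HN] := bleq_star_beyond bY YV.
    exists (maxn N (maxsize d.1.1)) => /HV HV' f y qf Yy y0 far; apply: HV' => //.
      by apply: HN => //; apply: beyond_le far; apply: leq_maxl.
    by apply: beyond_le far; apply: leq_maxr.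
  have [N HN] := choice loc.
  exists (level_max (l d) N) => f qf nw y Yy y0 far.
  apply: (HN _ (star d f qf nw)) => //; first exact: branch_restrict.
  by apply: beyond_le far; apply: leq_level_max; rewrite size_mkseq.
have [N HN] := choice NE.
have q3q1 : subtree q3 q1 by apply: subtree_trans q3q2 q2q1.
(* Were [w] false, I could keep it false forever, and then follow all the
   strategies for the positions [(x'^y_0..y_j, s^j)], which are all good. *)
have claim f x' s : branch q3 f -> Bad f x' s -> w (x', s, 0%N) f.
  move=> qf bad; apply: contrapT => nw; apply: bad.
  pose n := maxn (l2 (x', s, 0%N)) (l1 (x', s)).
  apply: (gdP _ _ (restrict q3 (mkseq f n))).
  - exact: branch_sub qf.
  - exact: perfect_restrict.
  - apply: subtree_trans (restrict_mono q3q1) _; exact: restrict_le (leq_maxr _ _).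
  (* [N] keeps [w] false. Term [i] follows the strategy for the position after [i.+1] vectors with
     [i] appended to [s], applied to the remaining vectors. *)
  exists Y; split=> //; exists (fun h => maxn (N (x' ++ h, s, size h))
    (\max_(i < size h) tau (x' ++ take i.+1 h, rcons s i) (drop i.+1 h))) => g ys rg /= fol.
  have qg : branch q3 g by apply: branch_sub rg; apply: restrict_subtree.
  have gf : mkseq g n = mkseq f n by have := restrict_branch rg; rewrite size_mkseq.
  have nwj j : ~ w (x' ++ mkseq ys j, s, j) g.
    elim: j => [|j IH].
      by rewrite cats0 /w (mkseq_le _ gf) // leq_maxl.
    have [y0 [Yy [far _]]] := fol j.
    have := HN _ g qg IH (ys j) Yy y0; rewrite /= -cats1 -catA cats1 -mkseqS; apply.
    by move=> i /far; apply: leq_ltn_trans; rewrite size_mkseq leq_maxl.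
  have gdj j : gd (x' ++ mkseq ys j.+1, rcons s j) g.
    (* Otherwise the position is bad, II may append [j] at once by [reach_done], and [w] would hold
       there. *)
    apply: contrapT => bad; apply: (nwj j.+1).
    set d := (_, _, _); set e := (_, _) in bad.
    have q2g : branch q2 g by apply: branch_sub qg.
    apply: (wP _ _ (restrict q2 (mkseq g (maxn (l2 d) (l1 e))))) => //.
    - exact: perfect_restrict.
    - exact: restrict_le (leq_maxl _ _).
    exists X; split=> // g' /restrict_branch; rewrite size_mkseq => gg'.
    by apply: reach_done; rewrite /Bad /gd (mkseq_le _ gg') // leq_maxr.
  (* [j] is the value of the witness right after [s]; the play after its first [j.+1] vectors
     contradicts the strategy for [rcons s j]. *)
  move=> [c [cs Cc]]; pose j := c (size s).
  apply: (Htau _ g _ (gdj j) (fun k => ys (k + j.+1)%N)).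
  - exact: branch_sub qg.
  - apply: F_follows_shift fol => k /=; rewrite size_mkseq leq_max; apply/orP; right.
    have jk : (j < k + j.+1)%N by rewrite addnS ltnS leq_addl.
    apply: leq_trans (leq_bigmax (Ordinal jk)) => /=.
    by rewrite mkseq_addn take_size_cat ?size_mkseq // drop_size_cat ?size_mkseq.
  rewrite /= outcome_shift; exists c; split=> // i; rewrite size_rcons ltnS leq_eqVlt.
  by rewrite nth_rcons => /orP[/eqP->|lt]; [rewrite ltnn eqxx | rewrite lt cs].
exists Y, q3; split=> //; split; first exact: bleq_trans YY1 Y1X.
split=> //; split; first by apply: subtree_trans q3q1 q1p.
right=> f qf.
have [||alpha [leg Hal]] := @reach_strategy _ (Bad f) Y x.
- move=> x' s /(claim _ _ _ qf) wf.
  apply: (w_reach Y (x', s, 0%N)) => //; last exact: branch_sub qf.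
  move=> a; have [V [HV Y2V]] := HY2 a; exists V; split=> //.
  exact: bleq_star_trans (fam_block famU UY2) bY YY2 Y2V.
- move=> G; apply: notGood; exists (restrict q1 (mkseq f (l1 (x, [::])))); split=> //.
    by apply: perfect_restrict => //; apply: q3q1.
  exact: subtree_trans (@restrict_subtree _ _) q1p.
exists alpha; split=> // Ys legI; apply/AC; have [g Hg] := Hal Ys legI; exists g.
apply: clC => n; have [k [s [nk ns bad gs]]] := Hg n.
set xk := x ++ _ in bad; pose m := maxn n (l1 (xk, s)).
(* The constant strategy [0] does not make the bad position good, so some point near the outcome
   lies in [piece s]; [m] secures agreement up to [n] and lets [gdP] apply. *)
have [f' [ys [rf' [c [cs Cc]]]]] : exists f' ys, branch (restrict q3 (mkseq f m)) f' /\
    piece s (f', outcome xk ys).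
  apply: contrapT => H; apply: bad; apply: (gdP _ _ (restrict q3 (mkseq f m))).
  - exact: branch_sub qf.
  - exact: perfect_restrict.
  - apply: subtree_trans (restrict_mono q3q1) _; exact: restrict_le (leq_maxr _ _).
  exists Y; split=> //; exists (fun=> 0%N) => f' ys rf' _ pc; by apply: H; exists f', ys.
exists (f', outcome xk ys), c; split=> // [i lt|i lt]; last first.
  by rewrite cs ?gs // (leq_trans lt).
have := restrict_branch rf'; rewrite size_mkseq => /(mkseq_le (leq_maxl n _)) ff'; split.
  by have := congr1 (nth false ^~ i) ff'; rewrite !nth_mkseq.
rewrite /= /outcome /xk size_cat size_mkseq.
rewrite (leq_trans (leq_trans lt nk)) ?leq_addl // nth_cat; case: ltnP => // xi.
by rewrite nth_mkseq // ltn_subLR // (leq_trans (leq_trans lt nk)) ?leq_addl.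
Qed.

End Main.

Theorem theorem6p4 (F : countFieldType) (U : (nat -> {poly F}) -> Prop) :
  is_strategic U -> is_pplus_filter U ->
  forall A : point F -> Prop, Borel A -> perfectly_strategically_Ramsey U A.
Proof.
move=> stratU [filU [fullU pU]] A /Borel_suslin[[C [clC AC]] _].
exact: perfectly_ramsey clC AC.
Qed.
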